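(* Let $n\ge 34$ be an even integer and let $D_n=2\lceil n/4\rceil-1$. Then every graph of order $n$ in which every vertex has degree $D_n$ or $D_n+1$ contains at least $\lceil n/4\rceil$ pairwise edge-disjoint perfect matchings.
   Context: All graphs are finite, simple, and undirected. Note $D_n=n/2-1$ if $n\equiv 0\pmod 4$ and $D_n=n/2$ if $n\equiv 2\pmod 4$. *)

(* Defs.v *)
From mathcomp Require Import all_boot.

Set Implicit Arguments.
Unset Strict Implicit.
Unset Printing Implicit Defensive.

(* The ceiling of m / d, for 0 < d. *)
Definition ceil_div (m d : nat) : nat := (m + d.-1) %/ d.

(* The truncated subtraction is exact as soon as 0 < n. *)
Definition Dn (n : nat) : nat := 2 * ceil_div n 4 - 1.

Section Graph.

Variables (T : finType) (e : rel T).

Definition simple_graph : Prop := symmetric e /\ irreflexive e.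

Definition degree (x : T) : nat := #|[set y | e x y]|.

Definition edges : {set {set T}} := [set [set x; y] | x in T, y in T & e x y].

Definition matching (M : {set {set T}}) : bool :=
  (M \subset edges) && trivIset M.

Definition perfect_matching (M : {set {set T}}) : bool :=
  matching M && (cover M == [set: T]).

End Graph.

(* Main.v *)
Require Import Defs.
From mathcomp Require Import all_boot zify.

Set Implicit Arguments.
Unset Strict Implicit.
Unset Printing Implicit Defensive.

(** Write [c] for the ceiling of [n / 4]. Suppose that fewer than [c] disjoint
    perfect matchings have been removed, and let [H] be what remains; its degrees
    are [d] or [d + 1] for some [d >= c]. Counting edges at a Tutte-Berge barrier
    shows that [H] has a perfect matching unless it has a weak cut: an odd set [U]
    with fewer than [d / 2] edges leaving it. Since every odd cut of the whole
    graph has at least [2c - 1] edges, some removed matching [M] crosses [U] at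
    least three times, and we exchange [M] for a perfect matching of [H + M] that
    crosses [U] only once. Two weak cuts of [H + M], taken up to one matching each,
    split the [n <= 4d] vertices into pieces of at least [d] vertices, so at most
    one further weak cut can get in the way; as the three pieces are then dense,
    the new matching can be chosen to cross that cut only once as well. Hence the
    total weakness of the odd cuts decreases until [H] has a perfect matching. *)

(** * Maximum matchings and the Tutte-Berge barrier *)

Lemma odd_gap a b : odd a = odd b -> a != b -> b <= a -> b.+2 <= a.
Proof.
move=> par; rewrite -(odd_double_half a) -(odd_double_half b) par -!muln2.
by case: (odd b); lia.
Qed.

Section Matchings.

Variable T : finType.
Implicit Types (g : rel T) (A B C S X Y : {set T}) (m f : {ffun T -> T}).

(* Matchings are involutions whose fixed points are the uncovered vertices. *)
Definition is_mtch g A m : bool :=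
  [forall x, (m (m x) == x) && ((m x == x) || g x (m x) && (x \in A))].

Lemma is_mtchP g A m :
  reflect [/\ involutive m, forall x, m x != x -> g x (m x)
            & forall x, m x != x -> x \in A] (is_mtch g A m).
Proof.
apply: (iffP forallP) => [mP|[mK mg mA] x].
  split=> [x|x|x]; have /andP[/eqP // _] := mP x;
    by case/orP=> [/eqP ->|/andP[]//]; rewrite eqxx.
rewrite mK eqxx /=; case: eqVneq => //= mx.
by rewrite mg ?mA.
Qed.

Definition missed A m : {set T} := [set x in A | m x == x].

(** Removing a two-element orbit from [C] changes neither the parity of [#|C|] nor the set of fixed
    points in [C]. *)
Lemma inv_parity m C : involutive m -> (forall x, x \in C -> m x \in C) ->
  odd #|C| = odd #|[set x in C | m x == x]|.
Proof.
move=> mK; have [k] := ubnP #|C|; elim: k C => // k IHk C ltCk stC.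
case: (pickP [pred x in C | m x != x]) => [x /andP[/= xC mx]|fixC]; last first.
  congr (odd #|pred_of_set _|); apply/setP=> x; rewrite inE.
  by have := fixC x; rewrite /=; case: (x \in C) => //= /negbFE.
pose C' := C :\: [set x; m x].
have cardC : #|C| = #|C'| + 2.
  have sub2 : [set x; m x] \subset C by rewrite subUset !sub1set xC stC.
  have := cardsID [set x; m x] C.
  by rewrite (setIidPr sub2) cards2 [x == _]eq_sym mx -/C' addnC => <-.
have -> : [set y in C | m y == y] = [set y in C' | m y == y].
  apply/setP=> y; rewrite !inE; have [->|nyx] := eqVneq y x.
    by rewrite (negPf mx) !andbF.
  by have [->|//] := eqVneq y (m x); rewrite mK eq_sym (negPf mx) !andbF.
rewrite -IHk ?cardC; [by rewrite oddD addbF|by move: ltCk; rewrite cardC; clear; lia|].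
move=> y; rewrite !inE negb_or => /andP[/andP[nyx nymx] yC].
by rewrite stC // andbT -{1}(mK x) !(inj_eq (inv_inj mK)) negb_or nymx.
Qed.

Lemma mtch_stable g A m x : is_mtch g A m -> x \in A -> m x \in A.
Proof.
case/is_mtchP=> mK _ mA xA; have [->//|mx] := eqVneq (m x) x.
by apply: mA; rewrite mK eq_sym.
Qed.

Lemma missed_parity g A m : is_mtch g A m -> odd #|A| = odd #|missed A m|.
Proof.
move=> mP; apply: inv_parity; first by case/is_mtchP: mP.
by move=> x; apply: mtch_stable mP.
Qed.

(** Intended for [x] fixed by [m]: the edge from [x] to [y] enters the matching, and the former
    partner of [y], if any, becomes a fixed point. *)
Definition upd m x y : {ffun T -> T} :=
  [ffun w => if w == x then y else if w == y then x else
             if w == m y then w else m w].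

Lemma upd_mtch g A m x y : symmetric g -> is_mtch g A m -> m x = x ->
  x \in A -> y \in A -> x != y -> g x y -> is_mtch g A (upd m x y).
Proof.
move=> gS /is_mtchP[mK mg mA] mx xA yA nxy gxy.
have mE a b : (m a == b) = (a == m b) by rewrite -{1}(mK b) (inj_eq (inv_inj mK)).
apply/is_mtchP; split=> w; rewrite !ffunE.
- have [->|nwx] := eqVneq w x; first by rewrite eq_sym (negPf nxy) eqxx.
  have [->|nwy] := eqVneq w y; first by rewrite eqxx.
  have [wm|nwm] := eqVneq w (m y).
    by rewrite (negPf nwx) (negPf nwy) wm eqxx.
  by rewrite !mE mx (negPf nwx) (negPf nwm) mK (negPf nwy).
- have [->//|nwx] := eqVneq w x; have [->|nwy] := eqVneq w y; first by rewrite gS.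
  by have [|_] := eqVneq w (m y); [rewrite eqxx|apply: mg].
- have [->//|nwx] := eqVneq w x; have [->//|nwy] := eqVneq w y.
  by have [|_] := eqVneq w (m y); [rewrite eqxx|apply: mA].
Qed.

Lemma missed_upd g A m x y : is_mtch g A m -> m x = x -> y \in A -> x != y ->
  missed A (upd m x y) =
  if m y == y then missed A m :\: [set x; y] else m y |: (missed A m :\ x).
Proof.
move=> mP mx yA nxy; have myA := mtch_stable mP yA.
have [mK mg mA] := is_mtchP _ _ _ mP.
have nmyx : m y != x by rewrite -{1}mx (inj_eq (inv_inj mK)) eq_sym.
apply/setP=> w; have [my|nmy] := eqVneq; rewrite !inE !ffunE.
  have [->|nwx] /= := eqVneq w x; first by rewrite eq_sym (negPf nxy) andbF.
  have [->|nwy] /= := eqVneq w y; first by rewrite (negPf nxy) andbF.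
  by rewrite my (negPf nwy).
have [->|nwx] /= := eqVneq w x.
  by rewrite eq_sym (negPf nxy) andbF eq_sym (negPf nmyx).
have [->|nwy] /= := eqVneq w y.
  by rewrite (negPf nxy) andbF eq_sym (negPf nmy) andbF.
by have [->|nwm] //= := eqVneq w (m y); rewrite myA eqxx.
Qed.

Definition min_mtch g A m :=
  is_mtch g A m /\ forall f, is_mtch g A f -> #|missed A m| <= #|missed A f|.

Lemma min_mtch_nonadj g A m x y : symmetric g -> min_mtch g A m ->
  x \in missed A m -> y \in missed A m -> x != y -> ~~ g x y.
Proof.
move=> gS [mP mmin] xm ym nxy; apply/negP=> gxy.
have [xA /eqP mx] : x \in A /\ m x == x by apply/andP; move: xm; rewrite inE.
have [yA my] : y \in A /\ m y == y by apply/andP; move: ym; rewrite inE.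
have := mmin _ (upd_mtch gS mP mx xA yA nxy gxy).
rewrite (missed_upd mP mx yA nxy) my leqNgt => /negP; apply.
apply: proper_card; apply/properP; split; first exact: subsetDl.
by exists x => //; rewrite !inE eqxx.
Qed.

(* Among the maximum matchings missing [K], one sharing the most edges with [f]
   misses no further vertex covered by [f]. *)
Lemma mtch_exchange g A f m (K : {set T}) : symmetric g ->
  is_mtch g A f -> min_mtch g A m -> K \subset missed A m ->
  exists m', [/\ min_mtch g A m', K \subset missed A m'
    & missed A m' :\: K \subset missed A f].
Proof.
move=> gS fP; have [fK fg fA] := is_mtchP _ _ _ fP.
pose ov (m' : {ffun T -> T}) := [set w | (f w == m' w) && (f w != w)].
have [k] := ubnP (#|T| - #|ov m|); elim: k m => // k IHk m ltk mmin Km.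
have [sub|] := boolP (missed A m :\: K \subset missed A f); first by exists m.
case/subsetPn=> x; rewrite !inE => /andP[xK /andP[xA /eqP mx]].
rewrite xA /= => fx; have [mP mle] := mmin; have [mK mg mA] := is_mtchP _ _ _ mP.
have yA := mtch_stable fP xA; have gxy := fg _ fx.
have nxy : x != f x by rewrite eq_sym.
have xm : x \in missed A m by rewrite inE xA mx eqxx.
have my : m (f x) != f x.
  apply/negP=> my; have := min_mtch_nonadj gS mmin xm _ nxy.
  by rewrite inE yA my gxy => /(_ isT).
have m'P := upd_mtch gS mP mx xA yA nxy gxy.
have missE := missed_upd mP mx yA nxy; rewrite (negPf my) in missE.
have mym : m (f x) \notin missed A m.
  by rewrite inE mK [f x == _]eq_sym (negPf my) andbF.
have card' : #|missed A (upd m x (f x))| = #|missed A m|.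
  rewrite missE cardsU1 !inE negb_and; move: mym; rewrite inE => ->; rewrite orbT.
  by rewrite (cardsD1 x (missed A m)) xm.
(* The inserted edge belongs to [f], while the edge it displaces at [f x] does not, as [m x = x];
   hence the agreement with [f] grows. *)
have ovP : ov m \proper ov (upd m x (f x)).
  apply/properP; split.
    apply/subsetP=> w; rewrite !inE !ffunE => /andP[/eqP fmw fw]; rewrite fw andbT.
    have [wx|nwx] := eqVneq w x; first by rewrite wx.
    have [wy|nwy] := eqVneq w (f x).
      by rewrite wy fK.
    have [wm|nwm] := eqVneq w (m (f x)); last by rewrite fmw.
    by move: nwx; rewrite -(inj_eq (inv_inj fK)) fmw wm mK eqxx.
  exists x; first by rewrite inE ffunE !eqxx fx.
  by rewrite inE mx fx andbT.
apply: (IHk (upd m x (f x))).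
- have := proper_card ovP; have : #|ov (upd m x (f x))| <= #|T| by apply: max_card.
  by move: ltk; clear; lia.
- by split=> // f' /mle; rewrite card'.
rewrite missE; apply/subsetP=> z zK; rewrite !inE.
have := subsetP Km z zK; rewrite inE => ->.
by rewrite andbT; apply/orP; right; apply: contraNneq xK => <-.
Qed.

(** The members of [P] are odd unions of components of [A :\: S]; being closed under adjacency is
    the form in which the counts below use them. *)
Definition barrier g A S (P : {set {set T}}) :=
  [/\ S \subset A, trivIset P
    & forall C, C \in P -> [/\ C \subset A :\: S, odd #|C|
      & forall x y, x \in C -> y \in A :\: S -> g x y -> y \in C]].

Lemma id_mtch g A : is_mtch g A [ffun x => x].
Proof. by apply/is_mtchP; split=> x; rewrite !ffunE ?eqxx. Qed.

Lemma ex_min_mtch g A : exists m, min_mtch g A m.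
Proof.
case: (arg_minnP (P := is_mtch g A) (fun m => #|missed A m|) (id_mtch g A)) => m mP mmin.
by exists m.
Qed.

(* When every vertex is missed by some maximum matching, "no maximum matching
   misses both" is an equivalence relation whose classes are odd and closed. *)
Lemma gallai_classes g A : symmetric g -> irreflexive g ->
  (forall v, v \in A -> exists2 m, min_mtch g A m & v \in missed A m) ->
  exists m P, [/\ min_mtch g A m, barrier g A set0 P & #|missed A m| <= #|P|].
Proof.
move=> gS gI allmiss; have [m mmin] := ex_min_mtch g A.
pose minb f := is_mtch g A f && (#|missed A f| == #|missed A m|).
have minbP f : reflect (min_mtch g A f) (minb f).
  have [mP mle] := mmin; apply: (iffP andP) => [[fP /eqP fm]|[fP fle]].
    by split=> // f' /mle; rewrite fm.
  by split=> //; rewrite eqn_leq fle ?mle.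
pose R x y := (x == y) ||
  [forall f, minb f ==> ~~ ((x \in missed A f) && (y \in missed A f))].
have RP x y f : R x y -> min_mtch g A f -> x \in missed A f -> y \in missed A f -> x = y.
  case/orP=> [/eqP//|/forallP /(_ f) Rf] /minbP fmin xf yf.
  by move: Rf; rewrite fmin xf yf.
have Rsym x y : R x y = R y x.
  by rewrite /R eq_sym; congr orb; apply: eq_forallb => f; rewrite [in RHS]andbC.
(* If a maximum [f] misses [x] and [z], exchange a maximum matching missing [y] towards [f], keeping
   [y] missed. The result misses neither [x] nor [z], and apart from [y] only vertices missed by
   [f], so it beats [f] by one. *)
have Rtrans x y z : y \in A -> R x y -> R y z -> R x z.
  move=> yA Rxy Ryz; apply/orP; have [|nxz] := eqVneq x z; [by left|right].
  apply/forallP=> f; apply/implyP=> /minbP fmin; apply/negP=> /andP[xf zf].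
  have [f0 f0min yf0] := allmiss y yA.
  have sub1 : [set y] \subset missed A f0 by rewrite sub1set.
  have [f' [f'min]] := mtch_exchange gS fmin.1 f0min sub1.
  rewrite sub1set => yf' sub.
  have nyf : y \notin missed A f.
    apply: contra nxz => yf; have := RP _ _ _ Rxy fmin xf yf.
    by have := RP _ _ _ Ryz fmin yf zf => -> ->.
  have nxf' : x \notin missed A f'.
    by apply: contraNN nyf => xf'; have <- := RP _ _ _ Rxy f'min xf' yf'.
  have nzf' : z \notin missed A f'.
    by apply: contraNN nyf => zf'; have -> := RP _ _ _ Ryz f'min yf' zf'.
  have := f'min.2 _ fmin.1; have := fmin.2 _ f'min.1.
  have : #|missed A f' :\ y| <= #|missed A f :\: [set x; z]|.
    apply: subset_leq_card; apply/subsetP=> w wf'.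
    rewrite inE (subsetP sub _ wf') andbT !inE negb_or.
    have wf : w \in missed A f' by move: wf'; rewrite !inE => /andP[].
    apply/andP; split.
      by apply: contraNneq nxf' => <-.
    by apply: contraNneq nzf' => <-.
  have sub2 : [set x; z] \subset missed A f by rewrite subUset !sub1set xf.
  rewrite (cardsDS sub2) cards2 nxz (cardsD1 y (missed A f')) yf'.
  have := subset_leq_card sub2; rewrite cards2 nxz; clear; lia.
have Radj x y : x \in A -> y \in A -> g x y -> R x y.
  move=> xA yA gxy; apply/orP; right; apply/forallP=> f; apply/implyP=> /minbP fmin.
  apply/negP=> /andP[xf yf]; have nxy : x != y.
    by apply: contraTneq gxy => ->; rewrite gI.
  by have := min_mtch_nonadj gS fmin xf yf nxy; rewrite gxy.
have Requiv : {in A & &, equivalence_rel R}.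
  move=> x y z xA yA zA; split; first by rewrite /R eqxx.
  move=> Rxy; apply/idP/idP; last exact: Rtrans.
  by apply: Rtrans => //; rewrite Rsym.
have partP := equivalence_partitionP Requiv.
have [/eqP covP trivP _] := and3P partP.
exists m, (equivalence_partition R A); split=> //.
  split=> [||C CP]; [exact: sub0set|exact: trivP|].
  have CA : C \subset A by rewrite -covP; apply: bigcup_sup CP.
  have nC : C != set0.
    by apply: contraTneq CP => ->; case/and3P: partP.
  have [x xC] := set0Pn _ nC; have xA := subsetP CA x xC.
  have CE : C = [set y in A | R x y].
    apply/setP=> y; rewrite inE; have [yA|nyA] /= := boolP (y \in A).
      rewrite -(pblock_equivalence_partition Requiv xA yA).
      by rewrite (def_pblock trivP CP xC).
    by apply: contraNF nyA; apply: (subsetP CA).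
  split; first by rewrite setD0.
    (* A maximum matching missing [x] preserves the class of [x], because adjacent vertices are
       related, and fixes only [x] there; so the class is odd. *)
    have [f fmin xf] := allmiss x xA; have [fP _] := fmin.
    have [fK fg fA] := is_mtchP _ _ _ fP.
    rewrite (inv_parity fK).
      suff -> : [set y in C | f y == y] = [set x] by rewrite cards1.
      apply/setP=> y; rewrite !inE CE inE; apply/idP/eqP => [|->].
        case/andP=> /andP[yA Rxy] fy.
        by rewrite -(RP _ _ _ Rxy fmin xf) // inE yA fy.
      by move: xf; rewrite !inE /R eqxx => /andP[-> ->].
    move=> y; rewrite CE !inE => /andP[yA Rxy]; rewrite (mtch_stable fP) //=.
    have [->//|fy] := eqVneq (f y) y.
    by apply: (Rtrans _ y) => //; apply: Radj => //; [apply: mtch_stable fP _|apply: fg].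
  move=> y z yC; rewrite setD0 => zA gyz; move: yC; rewrite CE !inE zA /=.
  by case/andP=> yA Rxy; apply: (Rtrans _ y) => //; apply: Radj.
have injP : {in missed A m &, injective (pblock (equivalence_partition R A))}.
  move=> x y xm ym; have xA : x \in A by move: xm; rewrite inE => /andP[].
  have yA : y \in A by move: ym; rewrite inE => /andP[].
  move=> eqb; apply: (RP _ _ m) => //.
  rewrite -(pblock_equivalence_partition Requiv xA yA) eqb mem_pblock.
  by rewrite covP.
rewrite -(card_in_imset injP); apply: subset_leq_card.
apply/subsetP=> _ /imsetP[x xm ->]; apply: pblock_mem; rewrite covP.
by move: xm; rewrite inE => /andP[].
Qed.

(** Induction on [#|A|]: a vertex covered by every maximum matching is deleted and put into [S];
    once no such vertex is left, the classes of [gallai_classes] serve with an empty barrier. *)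
Lemma berge g A : symmetric g -> irreflexive g ->
  exists m S P, [/\ min_mtch g A m, barrier g A S P
    & #|S| + #|missed A m| <= #|P|].
Proof.
move=> gS gI; have [k] := ubnP #|A|; elim: k A => // k IHk A ltAk.
have [m mmin] := ex_min_mtch g A.
case: (pickP [pred v in A | [forall f : {ffun T -> T},
  (is_mtch g A f && (#|missed A f| == #|missed A m|)) ==> (v \notin missed A f)]]).
  move=> v /andP[/= vA /forallP allv].
  have [|m' [S [P [m'min [SA trivP PP] leP]]]] := IHk (A :\ v).
    by have := cardsD1 v A; move: ltAk; rewrite vA; clear; lia.
  have [mP mle] := mmin; have [m'P _] := m'min; have [m'K m'g m'A] := is_mtchP _ _ _ m'P.
  have m'v : m' v = v.
    by apply/eqP; apply: contraT => /m'A; rewrite !inE eqxx.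
  have m'PA : is_mtch g A m'.
    by apply/is_mtchP; split=> // x /m'A; rewrite inE => /andP[].
  have missE : missed A m' = v |: missed (A :\ v) m'.
    apply/setP=> x; rewrite !inE; have [->|//] := eqVneq x v.
    by rewrite vA m'v eqxx.
  have cardE : #|missed A m'| = (#|missed (A :\ v) m'|).+1.
    by rewrite missE cardsU1 !inE eqxx.
  have neq : #|missed A m'| != #|missed A m|.
    have := allv m'; rewrite m'PA /=; apply: contraL => ->.
    by rewrite /= negbK inE vA m'v eqxx.
  have par : odd #|missed A m'| = odd #|missed A m|.
    by rewrite -(missed_parity m'PA) (missed_parity mP).
  have le' := mle _ m'PA.
  exists m, (v |: S), P; split=> //.
    split=> //; first by rewrite subUset sub1set vA (subset_trans SA) ?subsetDl.
    move=> C /PP[CA oddC cl]; have E : A :\: (v |: S) = (A :\ v) :\: S.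
      by apply/setP=> x; rewrite !inE negb_or andbCA andbA.
    by rewrite E.
  have vS : v \notin S by apply/negP=> /(subsetP SA); rewrite !inE eqxx.
  (* By parity [m'] misses at least two vertices of [A] more than [m] does. One of them is [v]; the
     other pays for adding [v] to [S]. *)
  have := odd_gap par neq le'; rewrite cardsU1 vS add1n.
  by rewrite cardE ltnS => lt; apply: leq_trans leP; rewrite addSnnS leq_add2l.
move=> nov; have [mP mle] := mmin.
have [|m' [P [m'min bP leP]]] := @gallai_classes g A gS gI.
  move=> v vA; have := nov v; rewrite /= vA /= => /negbT/forallPn[f].
  rewrite negb_imply negbK => /andP[/andP[fP /eqP fm] vf].
  by exists f => //; split=> // f' /mle; rewrite fm.
by exists m', set0, P; split=> //; rewrite cards0.
Qed.

End Matchings.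

(** * Edge counts at barriers *)

Lemma half_bounds d : 2 * d./2 <= d /\ d <= (2 * d./2).+1.
Proof. by have := odd_double_half d; rewrite -muln2; case: odd; lia. Qed.

(** There are [q] pieces with [t] vertices in all and [o] edges leaving them, [b] of the pieces
    having more than [d] vertices; [s] and [a] are the sizes of the barrier and of the whole set.
    The total size leaves [b <= 2], and then the bounds on [o] make [s] too large for
    [t + s <= a]. *)
Lemma near_pm_count (d h o t q s a b c : nat) :
  1 * q + d.+1 * b <= t + 1 * b -> d * q + 0 * b <= o + d * b ->
  o <= s * d.+1 + c -> t + s <= a -> a < 3 * d -> s + 3 <= q -> c < h ->
  2 * h <= d -> False.
Proof.
move=> h1 h2 h3 h4 h5 h6 h7 h8.
have b2 : b <= 2.
  rewrite leqNgt; apply/negP => b3; have := leq_mul (leqnn d) b3; lia.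
have := leq_mul (leqnn d) h6.
case: b b2 h1 h2 => [|[|[|//]]] _ h1 h2; lia.
Qed.

(** Same notation; [h] bounds from below the edges leaving a large piece, and [w] the size of any
    small piece. The total size now leaves [b <= 3]. *)
Lemma weak_count (d h o t q s a b w : nat) : 9 <= d ->
  1 * q + d.+1 * b <= t + 1 * b -> d * q + h * b <= o + d * b ->
  o <= s * d.+1 -> w * q + d.+1 * b <= t + w * b -> t + s <= a -> a <= 4 * d ->
  s + 2 <= q -> 1 <= w -> d.+1 <= w + s -> 2 * h <= d -> d <= (2 * h).+1 -> False.
Proof.
move=> d9 h1 h2 h3 h4 h5 h6 h7 w1 w2 dh1 dh2.
have b3 : b <= 3.
  rewrite leqNgt; apply/negP => b3; have := leq_mul (leqnn d) b3; lia.
have dq := leq_mul (leqnn d) h7.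
case: b b3 h1 h2 h4 => [|[|[|[|//]]]] _ h1 h2 h4.
- lia.
- lia.
(* Two large pieces force [s = d - 1], so every small piece has at least two vertices, and these no
   longer fit into [a <= 4 * d]. *)
- have sd : d <= s + 1 by lia.
  have [ds|sd'] := leqP d s; first lia.
  have w2' : 2 <= w by lia.
  have := leq_mul w2' (leqnn (q - 2)); rewrite mulnBr; lia.
(* Three large pieces alone leave [s <= 1], too few edges to separate them; with a fourth piece,
   that piece and the barrier already have [d + 1] vertices. *)
- have [q3|q4] := leqP q 3; first lia.
  have := leq_mul (leqnn w) q4; lia.
Qed.

(** Same notation with threshold [D] in place of [d], where [D + s] is the degree bound. The total
    size leaves [b <= 1], so at least [s + 1] pieces have [D] outgoing edges each. *)
Lemma dense_count (D s o t q b a : nat) :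
  1 * q + D.+1 * b <= t + 1 * b -> D * q + 0 * b <= o + D * b -> o < D + s ->
  t + s <= a -> a <= 2 * (D + s) -> s + 2 <= q -> 0 < D -> False.
Proof.
move=> h1 h2 h3 h4 h5 h6 D0.
have b1 : b <= 1.
  rewrite leqNgt; apply/negP => b3; have := leq_mul (leqnn D) b3; lia.
have := leq_mul (leqnn D) h6; have := leq_mul D0 (leqnn s).
case: b b1 h1 h2 => [|[|//]] _ h1 h2; lia.
Qed.

Section Counting.

Variable T : finType.
Implicit Types (g : rel T) (A B C S X Y : {set T}) (m f : {ffun T -> T}).

Definition deg_in g x Y := #|[set y in Y | g x y]|.

Definition links g X Y := \sum_(x in X) deg_in g x Y.

Definition cut g X := links g X (~: X).

Lemma deg_in_le g x Y : deg_in g x Y <= #|Y|.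
Proof. by apply: subset_leq_card; apply/subsetP=> y; rewrite inE => /andP[]. Qed.

Lemma deg_in_cover g x X Y Z : {in X, forall y, g x y -> y \in Y :|: Z} ->
  deg_in g x X <= deg_in g x Y + deg_in g x Z.
Proof.
move=> sub; apply: leq_trans (leq_card_setU _ _); apply: subset_leq_card.
apply/subsetP=> y; rewrite !inE => /andP[yX gxy].
by have := sub y yX gxy; rewrite inE gxy !andbT.
Qed.

Lemma deg_inS g x X Y : X \subset Y -> deg_in g x X <= deg_in g x Y.
Proof.
move=> sub; apply: subset_leq_card; apply/subsetP=> y; rewrite !inE.
by case/andP=> /(subsetP sub) -> ->.
Qed.

Lemma deg_in_self g x C : irreflexive g -> x \in C -> deg_in g x C < #|C|.
Proof.
move=> gI xC; apply: proper_card; apply/properP; split.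
  by apply/subsetP=> y; rewrite inE => /andP[].
by exists x => //; rewrite inE gI andbF.
Qed.

Lemma links_sym g X Y : symmetric g -> links g X Y = links g Y X.
Proof.
move=> gS; have E A B : links g A B = \sum_(x in A) \sum_(y in B) g x y.
  apply: eq_bigr => x _; rewrite /deg_in -sum1_card big_mkcond [RHS]big_mkcond.
  by apply: eq_bigr => y _; rewrite inE; case: (y \in B); case: (g x y).
rewrite !E exchange_big; apply: eq_bigr => x _; apply: eq_bigr => y _.
by rewrite gS.
Qed.

Lemma linksS g X X' Y Y' : X \subset X' -> Y \subset Y' ->
  links g X Y <= links g X' Y'.
Proof.
move=> sX sY; rewrite /links [leqRHS](big_setID X) (setIidPr sX) /=.
by apply: leq_trans (leq_addr _ _); apply: leq_sum => x _; apply: deg_inS.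
Qed.

Lemma cutC g X : symmetric g -> cut g (~: X) = cut g X.
Proof. by move=> gS; rewrite /cut setCK links_sym. Qed.

(** Each of the [a = #|X|] vertices contributes at least [d + 1 - a], and [a * (d + 1 - a) >= d]
    whenever [1 <= a <= d]. *)
Lemma small_out X d (out : T -> nat) :
  {in X, forall x, d < #|X| + out x} -> 0 < #|X| <= d -> d <= \sum_(x in X) out x.
Proof.
move=> outP /andP[X0 Xd]; apply: (@leq_trans (#|X| * (d.+1 - #|X|))).
  by move: X0 Xd; move: #|X|; clear => a; nia.
rewrite -sum_nat_const; apply: leq_sum => x xX; have := outP x xX.
by move: #|X| (out x); clear; lia.
Qed.

Lemma weak_large g d X : irreflexive g -> (forall x, d <= deg_in g x setT) ->
  cut g X < d -> X != set0 -> d < #|X|.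
Proof.
move=> gI gd ltc; rewrite -card_gt0 => X0; rewrite ltnNge; apply/negP=> Xd.
suff : d <= cut g X by rewrite leqNgt ltc.
apply: small_out; last by rewrite X0 Xd.
move=> x xX; apply: leq_ltn_trans (gd x) _.
apply: leq_ltn_trans (deg_in_cover (Y := X) (Z := ~: X) _) _.
  by move=> y _ _; rewrite setUCr inE.
by rewrite ltn_add2r deg_in_self.
Qed.

Lemma barrier_deg g A S P C x : irreflexive g -> barrier g A S P -> C \in P ->
  x \in C -> deg_in g x A < #|C| + deg_in g x S.
Proof.
move=> gI [SA _ PP] CP xC; have [CA _ cl] := PP C CP.
apply: leq_ltn_trans (deg_in_cover (Y := C) (Z := S) _) _; last first.
  by rewrite ltn_add2r deg_in_self.
move=> y yA gxy; rewrite inE; have [_|nyS] := boolP (y \in S); first by rewrite orbT.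
by rewrite (cl x y) // inE nyS.
Qed.

Lemma barrier_sum g A S P (F : T -> nat) : barrier g A S P ->
  \sum_(C in P) \sum_(x in C) F x <= \sum_(x in A :\: S) F x.
Proof.
move=> [SA triv PP]; rewrite -big_trivIset //=.
have sub : cover P \subset A :\: S by apply/bigcupsP=> C /PP[].
rewrite [leqRHS](big_setID (cover P)) (setIidPr sub) /=; exact: leq_addr.
Qed.

Lemma barrier_card g A S P : barrier g A S P -> \sum_(C in P) #|C| + #|S| <= #|A|.
Proof.
move=> bP; have := barrier_sum (fun=> 1) bP; rewrite sum1_card => le.
have [SA _ _] := bP; rewrite -(cardsID S A) (setIidPr SA) addnC leq_add2l.
by apply: leq_trans le; apply: leq_sum => C _; rewrite sum1_card.
Qed.

Lemma barrier_gt0 g A S P C : barrier g A S P -> C \in P -> 0 < #|C|.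
Proof. by case=> _ _ PP /PP[_ oC _]; case: #|C| oC. Qed.

(** The hypothesis says that [F C] is at least [b] on sets with more than [D] elements and at least
    [a] on the others; the terms are arranged so that no subtraction occurs. *)
Lemma sum_big_small (P : {set {set T}}) (a b D : nat) (F : {set T} -> nat) :
  {in P, forall C, a + b * (D < #|C|) <= F C + a * (D < #|C|)} ->
  a * #|P| + b * (\sum_(C in P) (D < #|C|)) <=
  \sum_(C in P) F C + a * (\sum_(C in P) (D < #|C|)).
Proof.
move=> le; rewrite mulnC -sum_nat_const !big_distrr -!big_split /=.
exact: leq_sum.
Qed.

Lemma pm_of_missed A m : #|missed A m| = 0 -> forall x, x \in A -> m x != x.
Proof.
move=> /cards0_eq E x xA; apply/negP=> mx.
by have := in_set0 x; rewrite -E inE xA mx.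
Qed.

Definition pm g A m := is_mtch g A m /\ forall x, x \in A -> m x != x.

(* A barrier has at most one component of more than [d - #|S|] vertices, and
   each of the others uses up at least [d - #|S|] of the total of [out]. *)
Lemma dense_pm g A d (out : T -> nat) : symmetric g -> irreflexive g ->
  ~~ odd #|A| -> #|A| <= 2 * d -> {in A, forall x, d <= deg_in g x A + out x} ->
  \sum_(x in A) out x < d -> exists m, pm g A m.
Proof.
move=> gS gI evA leA degA lto.
have [m [S [P [[mP _] bP leP]]]] := @berge T g A gS gI.
have par := missed_parity mP; rewrite (negPf evA) in par.
case E : #|missed A m| => [|k]; first by exists m; split=> //; apply: pm_of_missed E.
(* The deficiency has the parity of [#|A|], so it is at least two as soon as it is not zero. *)
have k1 : 0 < k by rewrite E in par; case: k par {E}.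
have q2 : #|S| + 2 <= #|P| by apply: leq_trans leP; rewrite leq_add2l E.
have cardP := barrier_card bP.
set D := d - #|S|; set b := \sum_(C in P) (D < #|C|).
have h1 : 1 * #|P| + D.+1 * b <= \sum_(C in P) #|C| + 1 * b.
  apply: sum_big_small => C CP; have := barrier_gt0 bP CP.
  by case: (ltnP D #|C|); move: #|C| (D); clear; lia.
(* For a barrier of [d] or more vertices, even pieces of a single vertex are too many for
   [#|A| <= 2 * d]. *)
have [leS|ltS] := leqP d #|S|.
  have : #|P| <= \sum_(C in P) #|C|.
    by rewrite -sum1_card; apply: leq_sum => C /(barrier_gt0 bP).
  move: cardP leA q2 leS; move: (\sum_(C in P) _) #|P| #|S| #|A|; clear; lia.
have h2 : D * #|P| + 0 * b <= \sum_(C in P) \sum_(x in C) out x + D * b.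
  apply: sum_big_small => C CP; rewrite mul0n addn0; case: (ltnP D #|C|) => CD.
    by rewrite muln1 leq_addl.
  rewrite muln0 addn0; apply: small_out; last by rewrite (barrier_gt0 bP CP).
  move=> x xC; have [_ _ PP] := bP; have [CA _ _] := PP C CP.
  have xA : x \in A by have := subsetP CA x xC; rewrite inE => /andP[].
  have := barrier_deg gI bP CP xC; have := degA x xA; have := deg_in_le g x S.
  rewrite /D; move: ltS; move: (deg_in g x A) (deg_in g x S) #|C| #|S| (out x).
  by clear; lia.
have h3 : \sum_(C in P) \sum_(x in C) out x < d.
  apply: leq_ltn_trans lto; apply: leq_trans (barrier_sum _ bP) _.
  by rewrite [leqRHS](big_setID (A :\: S)) setIDA setIid leq_addr.
have dE : d = D + #|S| by rewrite subnK // ltnW.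
rewrite dE in h3 leA; case: (dense_count h1 h2 h3 cardP leA q2).
by rewrite subn_gt0.
Qed.

(* At most two components have more than [d] vertices, since [#|Y| < 3 * d]. *)
Lemma near_pm g d Y : symmetric g -> irreflexive g ->
  (forall x, d <= deg_in g x setT <= d.+1) -> odd #|Y| -> #|Y| < 3 * d ->
  cut g Y < d./2 -> exists2 m, min_mtch g Y m & #|missed Y m| = 1.
Proof.
move=> gS gI gd oY leY ltc.
have [m [S [P [[mP mmin] bP leP]]]] := @berge T g Y gS gI.
have par := missed_parity mP; rewrite oY in par.
case E : #|missed Y m| => [|[|k]]; [by rewrite E in par|by exists m|].
(* Here the deficiency is odd and different from one, hence at least three. *)
have k1 : 0 < k by rewrite E in par; case: k par {E}.
have q2 : #|S| + 3 <= #|P| by apply: leq_trans leP; rewrite leq_add2l E.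
have cardP := barrier_card bP; have [SY _ PP] := bP.
set b := \sum_(C in P) (d < #|C|).
have h1 : 1 * #|P| + d.+1 * b <= \sum_(C in P) #|C| + 1 * b.
  apply: sum_big_small => C CP; have := barrier_gt0 bP CP.
  by case: (ltnP d #|C|); move: #|C|; clear; lia.
pose out x := deg_in g x S + deg_in g x (~: Y).
have h2 : d * #|P| + 0 * b <= \sum_(C in P) \sum_(x in C) out x + d * b.
  apply: sum_big_small => C CP; rewrite mul0n addn0; case: (ltnP d #|C|) => CD.
    by rewrite muln1 leq_addl.
  rewrite muln0 addn0; apply: small_out; last by rewrite (barrier_gt0 bP CP).
  move=> x xC; have := barrier_deg gI bP CP xC; have /andP[+ _] := gd x.
  have : deg_in g x setT <= deg_in g x Y + deg_in g x (~: Y).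
    by apply: deg_in_cover => y _ _; rewrite setUCr inE.
  rewrite /out; move: (deg_in g x setT) (deg_in g x Y) (deg_in g x S) #|C| (deg_in _ _ _).
  by clear; lia.
have h3 : \sum_(C in P) \sum_(x in C) out x <= #|S| * d.+1 + cut g Y.
  apply: leq_trans (barrier_sum _ bP) _; rewrite big_split /=; apply: leq_add.
    rewrite -/(links g _ S) links_sym // -sum_nat_const; apply: leq_sum => x _.
    by have /andP[_] := gd x; apply: leq_trans; apply: deg_inS; apply: subsetT.
  by apply: linksS => //; apply: subsetDl.
by case: (near_pm_count h1 h2 h3 cardP leY q2 ltc); case: (half_bounds d).
Qed.

(** At a barrier, a piece with more than [d] vertices sends at least [d./2] edges to [S] because no
    odd cut is weak, and a smaller piece at least [d]; yet [S] receives at most [#|S| * d.+1]. *)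
Lemma pm_of_no_weak g d : symmetric g -> irreflexive g ->
  (forall x, d <= deg_in g x setT <= d.+1) -> ~~ odd #|T| -> #|T| <= 4 * d ->
  9 <= d -> (forall X, odd #|X| -> d./2 <= cut g X) -> exists m, pm g setT m.
Proof.
move=> gS gI gd evT leT d9 strong.
have [m [S [P [[mP mmin] bP leP]]]] := @berge T g setT gS gI.
have par := missed_parity mP; rewrite cardsT (negPf evT) in par.
case E : #|missed setT m| => [|k]; first by exists m; split=> //; apply: pm_of_missed E.
have k1 : 0 < k by rewrite E in par; case: k par {E}.
have q2 : #|S| + 2 <= #|P| by apply: leq_trans leP; rewrite leq_add2l E.
have cardP := barrier_card bP; rewrite cardsT in cardP; have [_ _ PP] := bP.
set b := \sum_(C in P) (d < #|C|).
have h1 : 1 * #|P| + d.+1 * b <= \sum_(C in P) #|C| + 1 * b.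
  apply: sum_big_small => C CP; have := barrier_gt0 bP CP.
  by case: (ltnP d #|C|); move: #|C|; clear; lia.
pose out x := deg_in g x S.
have outE x C : C \in P -> x \in C -> d < #|C| + out x.
  by move=> CP xC; apply: leq_ltn_trans (barrier_deg gI bP CP xC); case/andP: (gd x).
have h2 : d * #|P| + d./2 * b <= \sum_(C in P) \sum_(x in C) out x + d * b.
  apply: sum_big_small => C CP; case: (ltnP d #|C|) => CD.
    rewrite !muln1 addnC leq_add2r; have [CA oC cl] := PP C CP.
    apply: leq_trans (strong C oC) _; apply: leq_sum => x xC.
    apply: subset_leq_card; apply/subsetP=> y; rewrite !inE => /andP[nyC gxy].
    rewrite gxy andbT; apply: contraNT nyC => nyS; apply: (cl x y) => //.
    by rewrite inE nyS inE.
  rewrite !muln0 !addn0; apply: small_out; last by rewrite (barrier_gt0 bP CP).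
  by move=> x; apply: outE.
have h3 : \sum_(C in P) \sum_(x in C) out x <= #|S| * d.+1.
  apply: leq_trans (barrier_sum _ bP) _.
  rewrite -/(links g _ S) links_sym // -sum_nat_const; apply: leq_sum => x _.
  by have /andP[_] := gd x; apply: leq_trans; apply: deg_inS; apply: subsetT.
(* A vertex of a piece has all its neighbours in that piece and in [S], so every piece has at least
   [d + 1 - #|S|] vertices. *)
set w := maxn 1 (d.+1 - #|S|).
have h4 : w * #|P| + d.+1 * b <= \sum_(C in P) #|C| + w * b.
  apply: sum_big_small => C CP; case: (ltnP d #|C|) => CD.
    by rewrite !muln1 addnC leq_add2r.
  rewrite !muln0 !addn0 /w geq_max (barrier_gt0 bP CP) /=.
  have /card_gt0P[x xC] := barrier_gt0 bP CP.
  have := outE x C CP xC; have := deg_in_le g x S; rewrite /out.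
  by move: #|C| #|S| (deg_in _ _ _); clear; lia.
have [dh1 dh2] := half_bounds d.
case: (weak_count d9 h1 h2 h3 h4 cardP leT q2 _ _ dh1 dh2); first exact: leq_maxl.
by rewrite addnC -leq_subLR leq_maxr.
Qed.

End Counting.

(** * Cuts after deleting a perfect matching *)

Section Swapping.

Variable T : finType.
Implicit Types (g K : rel T) (A B C S X Y U V W Z : {set T}) (m f : {ffun T -> T}).

Definition del K m : rel T := fun x y => K x y && (m x != y).

Definition crossers m X : {set T} := [set x in X | m x \notin X].

Definition mcut m X := #|crossers m X|.

Lemma del_sym K m : symmetric K -> involutive m -> symmetric (del K m).
Proof.
move=> KS mK x y; rewrite /del KS; congr (_ && ~~ _).
by rewrite -{1}(mK y) (inj_eq (inv_inj mK)) eq_sym.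
Qed.

Lemma del_irr K m : irreflexive K -> irreflexive (del K m).
Proof. by move=> KI x; rewrite /del KI. Qed.

Lemma del_sub K m : subrel (del K m) K.
Proof. by move=> x y /andP[]. Qed.

Lemma pm_inv g A m : pm g A m -> involutive m.
Proof. by case=> /is_mtchP[]. Qed.

Lemma pm_adj g A m x : pm g A m -> x \in A -> g x (m x).
Proof. by case=> /is_mtchP[_ mg _] nz /nz /mg. Qed.

Lemma pm_stable g A m x : pm g A m -> x \in A -> m x \in A.
Proof. by case=> mP _; apply: mtch_stable mP. Qed.

Lemma pm_mono g g' A m : subrel g g' -> pm g A m -> pm g' A m.
Proof.
move=> sub [/is_mtchP[mK mg mA] nz]; split=> //; apply/is_mtchP; split=> // x.
by move/mg/sub.
Qed.

Lemma deg_del K m x Y : pm K setT m ->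
  deg_in K x Y = deg_in (del K m) x Y + (m x \in Y).
Proof.
move=> mP; have Kx := pm_adj mP (in_setT x).
rewrite /deg_in (cardsD1 (m x)) inE Kx andbT addnC; congr (#|pred_of_set _| + _).
by apply/setP=> y; rewrite !inE /del eq_sym andbC -andbA.
Qed.

Lemma cut_del K m X : pm K setT m -> cut K X = cut (del K m) X + mcut m X.
Proof.
move=> mP; rewrite /cut /links; under eq_bigr do rewrite (deg_del _ _ mP).
rewrite big_split /=; congr (_ + _); rewrite /mcut -sum1_card.
rewrite big_mkcond [RHS]big_mkcond; apply: eq_bigr => x _; rewrite !inE.
by case: (x \in X); case: (m x \in X).
Qed.

(** The vertices of [X] that do not cross are paired with each other by [m]. *)
Lemma mcut_odd g m X : pm g setT m -> odd #|X| -> odd (mcut m X).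
Proof.
move=> mP oX; have mK := pm_inv mP; have [_ nz] := mP.
have ev : odd #|X :\: crossers m X| = false.
  rewrite (inv_parity mK) => [|x].
    rewrite (_ : [set _ in _ | _] = set0) ?cards0 //; apply/setP=> x; rewrite !inE.
    by rewrite (negPf (nz x _)) ?inE ?andbF.
  by rewrite !inE mK => /andP[]; case: (x \in X) => //=; rewrite !negbK => ->.
have sub : crossers m X \subset X by apply/subsetP=> x; rewrite inE => /andP[].
by move: oX; rewrite -(cardsID (crossers m X)) (setIidPr sub) oddD ev addbF.
Qed.

Lemma mcutC g m X : pm g setT m -> mcut m (~: X) = mcut m X.
Proof.
move=> mP; have mK := pm_inv mP.
rewrite /mcut -(card_imset _ (inv_inj mK)); congr #|pred_of_set _|.
apply/setP=> x; rewrite -{1}(mK x) (mem_imset _ _ (inv_inj mK)) !inE mK negbK.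
by rewrite andbC.
Qed.

Lemma glue g A B f m : pm g A f -> pm g B m -> [disjoint A & B] ->
  exists m', [/\ pm g (A :|: B) m', {in A, m' =1 f} & {in B, m' =1 m}].
Proof.
move=> fP mP dAB; have fK := pm_inv fP; have mK := pm_inv mP.
have BA x : x \in B -> (x \in A) = false by move=> xB; rewrite (disjointFl dAB).
pose m' : {ffun T -> T} := [ffun x => if x \in A then f x else m x].
have m'A : {in A, m' =1 f} by move=> x xA; rewrite ffunE xA.
have m'B : {in B, m' =1 m} by move=> x /BA xA; rewrite ffunE xA.
exists m'; split=> //; split.
  apply/is_mtchP; split=> x.
  - have [xA|nxA] := boolP (x \in A).
      by rewrite (m'A x xA) (m'A _ (pm_stable fP xA)) fK.
    have [xB|nxB] := boolP (x \in B).
      by rewrite (m'B x xB) (m'B _ (pm_stable mP xB)) mK.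
    have m'x : m' x = x.
      rewrite ffunE (negPf nxA); apply/eqP; apply: contraNT nxB.
      by case: mP => /is_mtchP[_ _ mB] _ /mB.
    by rewrite !m'x.
  - rewrite ffunE; case: ifP => [xA _|_]; first exact: pm_adj fP _.
    by case: mP => /is_mtchP[_ mg _] _ /mg.
  rewrite ffunE inE; case: ifP => // _.
  by case: mP => /is_mtchP[_ _ mB] _ /mB.
move=> x; rewrite inE; have [xA _|nxA /= xB] := boolP (x \in A).
  by rewrite m'A //; apply: fP.2.
by rewrite m'B //; apply: mP.2.
Qed.

Lemma edge_pm g u v : symmetric g -> g u v -> u != v ->
  exists m, [/\ pm g [set u; v] m, m u = v & m v = u].
Proof.
move=> gS guv nuv; have fP := id_mtch g [set u; v].
have fu : [ffun x => x] u = u by rewrite ffunE.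
exists (upd [ffun x => x] u v); split.
- split; first by apply: upd_mtch; rewrite ?inE ?eqxx ?orbT.
  move=> x; rewrite !inE !ffunE; case: eqVneq => [-> _|nxu /= /eqP ->].
    by rewrite eq_sym.
  by rewrite eqxx.
- by rewrite ffunE eqxx.
by rewrite ffunE eqxx eq_sym (negPf nuv).
Qed.

(** Keeps the edges of [m] inside [A]. Used with [pm_exchange], it lets the vertex left over in [A]
    be one whose [m]-edge leaves [A]. *)
Lemma restrict_mtch g A B m : is_mtch g B m ->
  exists2 f, is_mtch g A f
    & forall x, x \in missed A f -> x \in A /\ (m x \notin A \/ m x = x).
Proof.
case/is_mtchP=> mK mg mB.
pose r : {ffun T -> T} := [ffun x => if (x \in A) && (m x \in A) then m x else x].
have r1 x : x \in A -> m x \in A -> r x = m x by move=> xA mA; rewrite ffunE xA mA.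
have r0 x : ~~ ((x \in A) && (m x \in A)) -> r x = x.
  by move=> nx; rewrite ffunE (negPf nx).
exists r.
  apply/is_mtchP; split=> x;
    have [/andP[xA mA]|nx] := boolP ((x \in A) && (m x \in A)).
  - by rewrite (r1 x) // r1 ?mK.
  - by rewrite !r0.
  - by rewrite r1 //; apply: mg.
  - by rewrite r0 ?eqxx.
  - by rewrite r1.
  - by rewrite r0 ?eqxx.
move=> x; rewrite inE => /andP[xA rx]; split=> //.
have [mA|] := boolP (m x \in A); [right|by left].
by rewrite -(r1 x) //; apply/eqP.
Qed.

Lemma pm_missed1 g A m b : is_mtch g A m -> missed A m = [set b] ->
  pm g (A :\ b) m.
Proof.
move=> mP E; have [mK mg mA] := is_mtchP _ _ _ mP.
have mb : m b = b.
  by have := set11 b; rewrite -E inE => /andP[_ /eqP].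
split.
  apply/is_mtchP; split=> // x mx; rewrite !inE mA // andbT.
  by apply: contraNneq mx => ->; rewrite mb.
move=> x; rewrite !inE => /andP[nxb xA]; apply: contraNN nxb => mx.
by rewrite -in_set1 -E inE xA.
Qed.

(** Any matching [f] can steer which vertex a near-perfect matching leaves uncovered:
    [mtch_exchange] is applied with nothing prescribed as missed. *)
Lemma pm_exchange g A f m : symmetric g ->
  is_mtch g A f -> min_mtch g A m -> #|missed A m| = 1 ->
  exists m' b, [/\ b \in missed A f & pm g (A :\ b) m'].
Proof.
move=> gS fP mmin m1.
have [m' [m'min _ sub]] := mtch_exchange gS fP mmin (sub0set _).
have : #|missed A m'| = 1.
  by apply/eqP; rewrite -m1 eqn_leq m'min.2 ?mmin.2 ?mmin.1 ?m'min.1.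
move/eqP/cards1P=> [b E]; exists m', b; split; last exact: pm_missed1 m'min.1 E.
by apply: (subsetP sub); rewrite setD0 E set11.
Qed.

(** Deleting [x0] costs each vertex at most one neighbour, and the other losses are edges of the
    cut, fewer than [d - 1] in all; so [dense_pm] applies with degree bound [d - 1]. *)
Lemma weak_pm g d X x0 : symmetric g -> irreflexive g ->
  (forall x, d <= deg_in g x setT) -> odd #|X| -> #|X| < 2 * d ->
  cut g X < d.-1 -> x0 \in X -> exists m, pm g (X :\ x0) m.
Proof.
move=> gS gI gd oX leX ltc x0X; have cX := cardsD1 x0 X; rewrite x0X add1n in cX.
apply: (@dense_pm _ g _ d.-1 (fun x => deg_in g x (~: X))) => //.
- by move: oX; rewrite cX.
- by move: leX; rewrite cX; move: #|_|; clear; lia.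
- move=> x xX; have := gd x.
  have : deg_in g x setT <= deg_in g x X + deg_in g x (~: X).
    by apply: deg_in_cover => y _ _; rewrite setUCr inE.
  have : deg_in g x X <= deg_in g x (X :\ x0) + deg_in g x [set x0].
    by apply: deg_in_cover => y yX _; rewrite setUC setD1K.
  have := deg_in_le g x [set x0]; rewrite cards1.
  move: (deg_in g x _) (deg_in g x X) (deg_in g x _) (deg_in g x _) (deg_in g x _).
  by clear; lia.
by apply: leq_ltn_trans ltc; apply: linksS => //; apply: subsetDl.
Qed.

End Swapping.

(** * Exchanging a matching across a weak cut *)

Section WeakCuts.

Variables (T : finType) (K : rel T) (d : nat).
Implicit Types (X Y U V W Z : {set T}) (m f : {ffun T -> T}).

Hypotheses (KS : symmetric K) (KI : irreflexive K)
  (Kd : forall x, d.+1 <= deg_in K x setT <= d.+2)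
  (evT : ~~ odd #|T|) (leT : #|T| <= 4 * d) (d9 : 9 <= d).

(** [K] is the remaining graph with one removed matching put back; [H m] is what remains when [m] is
    taken out instead. *)
Let H m := del K m.
Let HS m : pm K setT m -> symmetric (H m).
Proof. by move/pm_inv; apply: del_sym. Qed.
Let HI m : irreflexive (H m).
Proof. exact: del_irr. Qed.

Let weak m X := cut (H m) X < d./2.

Lemma deg_del_range m x : pm K setT m -> d <= deg_in (H m) x setT <= d.+1.
Proof. by move=> mP; have := Kd x; rewrite (deg_del _ _ mP) inE addn1 !ltnS. Qed.

Lemma degH_ge m x : pm K setT m -> d <= deg_in (H m) x setT.
Proof. by move/(@deg_del_range _ x)/andP=> []. Qed.

Lemma lt_half c : c < d./2 -> c < d.-1.
Proof. by have [] := half_bounds d; move: d9; lia. Qed.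

Lemma weakC m X : pm K setT m -> weak m (~: X) = weak m X.
Proof. by move=> mP; rewrite /weak cutC //; apply: HS. Qed.

Lemma weak_size m X : pm K setT m -> weak m X -> X != set0 -> d < #|X|.
Proof.
move=> mP wX; apply: weak_large (HI m) _ _; first by move=> x; apply: degH_ge.
by apply: leq_trans (lt_half wX) (leq_pred d).
Qed.

Lemma odd_setC X : odd #|~: X| = odd #|X|.
Proof.
have := cardsC X; move/(congr1 odd); rewrite oddD (negPf evT).
by case: odd; case: odd.
Qed.

Lemma deg_out m x X : pm K setT m -> deg_in K x X <= (deg_in (H m) x X).+1.
Proof. by move=> mP; rewrite (deg_del _ _ mP) -addn1 leq_add2l leq_b1. Qed.

(** An edge leaving the intersection leaves [X1] or [X2]. Up to one edge of each matching per
    vertex, it is counted by one of the two weak cuts, which together have fewer than [d - 1] edges;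
    [small_out] then excludes a small intersection. *)
Lemma piece_size m1 m2 X1 X2 : pm K setT m1 -> pm K setT m2 ->
  weak m1 X1 -> weak m2 X2 -> X1 :&: X2 != set0 -> d <= #|X1 :&: X2|.
Proof.
move=> m1P m2P w1 w2; rewrite -card_gt0 => P0; rewrite leqNgt; apply/negP=> Pd.
set P := X1 :&: X2 in P0 Pd *.
pose out x := deg_in (H m1) x (~: X1) + deg_in (H m2) x (~: X2).
have : d.-1 <= \sum_(x in P) out x.
  apply: small_out; last by move: P0 Pd; move: #|P|; clear; lia.
  move=> x xP; have /andP[+ _] := Kd x; have := deg_in_self KI xP.
  have : deg_in K x setT <= deg_in K x P + deg_in K x (~: P).
    by apply: deg_in_cover => y _ _; rewrite setUCr inE.
  have : deg_in K x (~: P) <= deg_in K x (~: X1) + deg_in K x (~: X2).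
    by apply: deg_in_cover => y; rewrite setCI.
  have := deg_out x (~: X1) m1P; have := deg_out x (~: X2) m2P; rewrite /out.
  move: #|P| (deg_in K x setT) (deg_in K x P) (deg_in K x (~: P)).
  move: (deg_in K x (~: X1)) (deg_in K x (~: X2)) (deg_in _ x (~: X1)).
  by move: (deg_in _ x (~: X2)); clear; lia.
have : \sum_(x in P) out x <= cut (H m1) X1 + cut (H m2) X2.
  by rewrite big_split; apply: leq_add; apply: linksS; rewrite // ?subsetIl ?subsetIr.
move: w1 w2; rewrite /weak; move: (cut _ X1) (cut _ X2) (\sum_(x in P) _).
by have [] := half_bounds d; move: d9; clear; lia.
Qed.

Lemma mcut1 m X u : u \in X -> m u \notin X ->
  (forall x, x \in X :\ u -> m x \in X :\ u) -> mcut m X = 1.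
Proof.
move=> uX mu st; rewrite /mcut (_ : crossers m X = [set u]) ?cards1 //.
apply/setP=> x; rewrite !inE; have [->|nxu] := eqVneq x u; first by rewrite uX mu.
apply/negP=> /andP[xX]; have : x \in X :\ u by rewrite !inE nxu.
by move/st; rewrite inE => /andP[_ ->].
Qed.

Lemma weak_pm_del m X x0 : pm K setT m -> odd #|X| -> #|X| < 2 * d -> weak m X ->
  x0 \in X -> exists f, pm K (X :\ x0) f.
Proof.
move=> mP oX leX wX x0X.
have [//|f fP] := weak_pm (HS mP) (HI m) (fun x => degH_ge x mP) oX leX _ x0X.
  exact: lt_half.
by exists f; apply: pm_mono fP; apply: del_sub.
Qed.

(** The new matching consists of one edge of [m] across [U] and perfect matchings of what is left on
    either side. *)
Lemma swap_one m U : pm K setT m -> odd #|U| -> #|U| < 2 * d -> weak m U ->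
  exists2 m', pm K setT m' & mcut m' U = 1.
Proof.
move=> mP oU leU wU; have mK := pm_inv mP; have [mM mnz] := mP.
have oY : odd #|~: U| by rewrite odd_setC.
have U0 : U != set0 by apply: contraTneq oU => ->; rewrite cards0.
have dU := weak_size mP wU U0.
have [||N [NP Nmin] N1] := @near_pm _ (H m) d (~: U) (HS mP) (HI m)
    (fun x => deg_del_range x mP) oY.
- by have := cardsC U; move: dU leT; move: #|U| #|~: U| #|T|; clear; lia.
- by have := wU; rewrite -weakC.
(* Maximality carries over from [H m] to [K], since an odd set always has an uncovered vertex. *)
have NK : min_mtch K (~: U) N.
  split=> [|f fP]; last first.
    by rewrite N1; have := missed_parity fP; rewrite oY; case: #|_|.
  by case/is_mtchP: NP => ? Ng ?; apply/is_mtchP; split=> // x /Ng/del_sub.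
(* Restricted to the complement, [m] leaves uncovered only ends of edges crossing [U], so the
   uncovered vertex [b] can be joined to [m b] in [U]. *)
have [f fP fmiss] := restrict_mtch (~: U) mM.
have [N' [b [bf N'P]]] := pm_exchange KS fP NK N1.
have [bY [|/eqP]] := fmiss b bf; last by rewrite (negPf (mnz b _)).
rewrite inE negbK => ubU; set u := m b in ubU.
have [h hP] := weak_pm_del mP oU leU wU ubU.
have nub : u != b by apply: contraTneq ubU => ->; move: bY; rewrite inE.
have Kub : K u b by rewrite KS; apply: pm_adj mP _.
have [e [eP eu eb]] := edge_pm KS Kub nub.
have bU : b \notin U by move: bY; rewrite inE.
have d1 : [disjoint U :\ u & ~: U :\ b].
  rewrite -setI_eq0; apply/eqP/setP=> x; rewrite !inE.
  by case: (x \in U); rewrite ?andbF.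
have [m1 [m1P m1U m1Y]] := glue hP N'P d1.
have d2 : [disjoint U :\ u :|: ~: U :\ b & [set u; b]].
  rewrite -setI_eq0; apply/eqP/setP=> x; rewrite !inE.
  have [->|] := eqVneq x u; first by rewrite ubU andbF.
  by have [->|] := eqVneq x b; rewrite ?(negPf bU) ?andbF.
have [m' [m'P m'1 m'2]] := glue m1P eP d2.
exists m'.
  suff <- : U :\ u :|: ~: U :\ b :|: [set u; b] = setT by [].
  apply/setP=> x; rewrite !inE; case: (x == u); case: (x == b); rewrite ?orbT //=.
  by rewrite orbN.
apply: (mcut1 ubU); first by rewrite m'2 ?eu // !inE eqxx.
move=> x xU; rewrite m'1; last by rewrite inE xU.
by rewrite m1U //; apply: pm_stable hP _.
Qed.

(** Each vertex of [Z] has degree at least [d + 1]; one edge of each matching is written off, and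
    the other edges leaving [Z] belong to the two weak cuts. Thus [dense_pm] applies with bound
    [d - 1]. *)
Lemma mid_pm m1 m2 U V Z : pm K setT m1 -> pm K setT m2 -> weak m1 U ->
  weak m2 V -> Z = ~: (U :|: V) -> ~~ odd #|Z| -> #|Z| <= 2 * d.-1 ->
  exists f, pm K Z f.
Proof.
move=> m1P m2P w1 w2 ZE evZ leZ.
apply: (@dense_pm _ K Z d.-1
  (fun x => deg_in (H m1) x U + deg_in (H m2) x V)) => //.
  move=> x xZ; have /andP[+ _] := Kd x.
  have : deg_in K x setT <= deg_in K x Z + deg_in K x (~: Z).
    by apply: deg_in_cover => y _ _; rewrite setUCr inE.
  have : deg_in K x (~: Z) <= deg_in K x U + deg_in K x V.
    by apply: deg_in_cover => y; rewrite ZE setCK.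
  have := deg_out x U m1P; have := deg_out x V m2P.
  move: (deg_in K x setT) (deg_in K x Z) (deg_in K x (~: Z)).
  move: (deg_in K x U) (deg_in K x V) (deg_in _ x U) (deg_in _ x V).
  by clear; lia.
have : \sum_(x in Z) (deg_in (H m1) x U + deg_in (H m2) x V) <=
    cut (H m1) U + cut (H m2) V.
  rewrite big_split -[cut _ U]cutC -?[cut _ V]cutC; try exact: HS.
  by apply: leq_add; apply: linksS; rewrite ?setCK // ZE setCS ?subsetUl ?subsetUr.
move: w1 w2; rewrite /weak; move: (cut _ U) (cut _ V) (\sum_(x in Z) _).
by have [] := half_bounds d; move: d9; clear; lia.
Qed.

(** An edge of [K] between [U] and [V], if there is one, serves as the crossing edge of both, and
    [Z] is matched within itself. Otherwise [U] and [V] are each joined to [Z] by an edge of [m'].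
    Which case occurred is recorded for the end of [swap]. *)
Lemma swap_two m m' U V Z : pm K setT m -> pm K setT m' -> odd #|U| -> odd #|V| ->
  [disjoint U & V] -> weak m U -> weak m' V -> #|U| < 2 * d -> #|V| < 2 * d ->
  Z = ~: (U :|: V) -> ~~ odd #|Z| -> #|Z| <= 2 * d.-1 -> mcut m' U = 1 ->
  exists m'', [/\ pm K setT m'', mcut m'' U = 1, mcut m'' V = 1
    & (forall x, x \in Z -> m'' x \in Z) \/
      (forall u v, u \in U -> v \in V -> ~~ K u v)].
Proof.
move=> mP m'P oU oV dUV wU wV leU leV ZE evZ leZ m'U.
have [h hP] := mid_pm mP m'P wU wV ZE evZ leZ.
have inZ x : (x \in Z) = (x \notin U) && (x \notin V) by rewrite ZE !inE negb_or.
have UV x : x \in U -> (x \in V) = false by move=> xU; rewrite (disjointFr dUV).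
have VU x : x \in V -> (x \in U) = false by move=> xV; rewrite (disjointFl dUV).
case: (pickP [pred p : T * T | [&& p.1 \in U, p.2 \in V & K p.1 p.2]]).
  case=> u v /and3P[/= uU vV Kuv]; have uV := UV u uU; have vU := VU v vV.
  have nuv : u != v by apply: contraTneq uU => ->; rewrite vU.
  have [f1 f1P] := weak_pm_del mP oU leU wU uU.
  have [f2 f2P] := weak_pm_del m'P oV leV wV vV.
  have [e [eP eu ev]] := edge_pm KS Kuv nuv.
  have d1 : [disjoint U :\ u & V :\ v].
    rewrite -setI_eq0; apply/eqP/setP=> x; rewrite !inE.
    by have [/UV ->|] := boolP (x \in U); rewrite ?andbF.
  have [m1 [m1P m1U m1V]] := glue f1P f2P d1.
  have d2 : [disjoint U :\ u :|: V :\ v & Z].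
    rewrite -setI_eq0; apply/eqP/setP=> x; rewrite !inE inZ.
    by case: (x \in U); case: (x \in V); rewrite ?andbF.
  have [m2 [m2P m21 m2Z]] := glue m1P hP d2.
  have d3 : [disjoint U :\ u :|: V :\ v :|: Z & [set u; v]].
    rewrite -setI_eq0; apply/eqP/setP=> x; rewrite !inE inZ.
    have [->|] := eqVneq x u; first by rewrite uU uV ?andbF.
    by have [->|] := eqVneq x v; rewrite ?vU ?vV ?andbF.
  have [m3 [m3P m32 m3e]] := glue m2P eP d3.
  have m3Z x : x \in Z -> m3 x \in Z.
    move=> xZ; rewrite m32; last by rewrite inE xZ orbT.
    by rewrite m2Z //; apply: pm_stable hP _.
  exists m3; split; [| | |by left].
  - suff <- : U :\ u :|: V :\ v :|: Z :|: [set u; v] = setT by [].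
    apply/setP=> x; rewrite !inE inZ; case: (x == u); case: (x == v); rewrite ?orbT //=.
    by case: (x \in U); case: (x \in V).
  - apply: (mcut1 uU); first by rewrite m3e ?eu ?vU // !inE eqxx.
    move=> x xU; rewrite m32; last by rewrite !in_setU xU.
    rewrite m21; last by rewrite !in_setU xU.
    by rewrite m1U //; apply: pm_stable f1P _.
  - apply: (mcut1 vV); first by rewrite m3e ?ev ?uV // !inE eqxx orbT.
    move=> x xV; rewrite m32; last by rewrite !in_setU xV orbT.
    rewrite m21; last by rewrite !in_setU xV orbT.
    by rewrite m1V //; apply: pm_stable f2P _.
move=> noK; have noUV u v : u \in U -> v \in V -> ~~ K u v.
  by move=> uU vV; have := noK (u, v); rewrite /= uU vV /= => ->.
have m'K := pm_inv m'P; have [m'M m'nz] := m'P.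
(* The only edge of [m'] leaving [U] ends in [Z], as [K] has no edge between [U] and [V]. *)
have /eqP/cards1P[u uE] := m'U; have : u \in crossers m' U by rewrite uE set11.
rewrite inE => /andP[uU]; set b := m' u => bU.
have Kub : K u b by apply: pm_adj m'P _.
have bV : (b \in V) = false.
  by apply/negP=> bV; have := noUV u b uU bV; rewrite Kub.
have bZ : b \in Z by rewrite inZ bU bV.
have cZ := cardsD1 b Z; rewrite bZ add1n in cZ.
have oA : odd #|Z :\ b| by move: evZ; rewrite cZ negbK.
have min1 f : is_mtch K (Z :\ b) f -> 0 < #|missed (Z :\ b) f|.
  by move/missed_parity; rewrite oA; case: #|_|.
(* Without [b], the perfect matching [h] of [Z] misses only [h b], which is optimal on an odd
   set. *)
have [N NP Nmiss] := restrict_mtch (Z :\ b) hP.1.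
have N1 : #|missed (Z :\ b) N| = 1.
  apply/eqP; rewrite eqn_leq min1 // andbT -(cards1 (h b)); apply: subset_leq_card.
  apply/subsetP=> x /Nmiss[]; rewrite !inE => /andP[nxb xZ].
  rewrite (pm_stable hP xZ) andbT negbK => -[/eqP <-|/eqP].
    by rewrite (pm_inv hP).
  by rewrite (negPf (hP.2 x xZ)).
have Nmin : min_mtch K (Z :\ b) N by split=> // f fP; rewrite N1 min1.
(* Steering by [m'] leaves a vertex [z] whose partner is outside [Z :\ b]. The partner is neither
   [b] nor in [U], because [m'] crosses [U] only along the edge from [u] to [b]; so it lies in
   [V]. *)
have [f fP fmiss] := restrict_mtch (Z :\ b) m'M.
have [N' [z [zf N'P]]] := pm_exchange KS fP Nmin N1.
have [zA [|/eqP]] := fmiss z zf; last by rewrite (negPf (m'nz z _)).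
have [nzb zZ] : z != b /\ z \in Z by move: zA; rewrite !inE => /andP[].
have [zU zV] : (z \in U) = false /\ (z \in V) = false.
  by move: zZ; rewrite inZ => /andP[/negPf -> /negPf ->].
set v := m' z => nvA; have m'v : m' v = z by rewrite m'K.
have vb : v != b.
  apply: contraFneq zU => vb; move: (m'v); rewrite vb /b m'K => <-; exact: uU.
have vU : (v \in U) = false.
  apply/negP=> vU; have : v \in crossers m' U by rewrite inE vU m'v zU.
  by rewrite uE inE => /eqP vu; move: nzb; rewrite -m'v vu eqxx.
have vV : v \in V by move: nvA; rewrite !inE vb inZ vU /= negbK.
have uV := UV u uU.
have [f1 f1P] := weak_pm_del mP oU leU wU uU.
have [f2 f2P] := weak_pm_del m'P oV leV wV vV.
have nub : u != b by apply: contraNneq bU => <-.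
have nzv : z != v by apply: contraFneq zV => ->.
have nuz : u != z by apply: contraFneq zU => <-.
have nuv : u != v by apply: contraFneq vU => <-.
have Kzv : K z v by apply: pm_adj m'P _.
have [e1 [e1P e1u e1b]] := edge_pm KS Kub nub.
have [e2 [e2P e2z e2v]] := edge_pm KS Kzv nzv.
have d1 : [disjoint U :\ u & V :\ v].
  rewrite -setI_eq0; apply/eqP/setP=> x; rewrite !inE.
  by have [/UV ->|] := boolP (x \in U); rewrite ?andbF.
have [m1 [m1P m1U m1V]] := glue f1P f2P d1.
have d2 : [disjoint U :\ u :|: V :\ v & Z :\ b :\ z].
  rewrite -setI_eq0; apply/eqP/setP=> x; rewrite !inE inZ.
  by case: (x \in U); case: (x \in V); rewrite ?andbF.
have [m2 [m2P m21 m2Z]] := glue m1P N'P d2.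
have d3 : [disjoint U :\ u :|: V :\ v :|: Z :\ b :\ z & [set u; b]].
  rewrite -setI_eq0; apply/eqP/setP=> x; rewrite !inE inZ.
  have [->|] := eqVneq x u; first by rewrite uU uV ?andbF.
  by have [->|] := eqVneq x b; rewrite ?(negPf bU) ?bV ?andbF.
have [m3 [m3P m32 m3e]] := glue m2P e1P d3.
have d4 : [disjoint U :\ u :|: V :\ v :|: Z :\ b :\ z :|: [set u; b] & [set z; v]].
  rewrite -setI_eq0; apply/eqP/setP=> x; rewrite !inE inZ.
  have [->|] := eqVneq x z.
    by rewrite zU zV (negPf nzb) eq_sym (negPf nuz) ?andbF.
  have [->|] := eqVneq x v; rewrite ?andbF //.
  by rewrite vU vV (negPf vb) [v == u]eq_sym (negPf nuv) /= ?andbF.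
have [m4 [m4P m43 m4e]] := glue m3P e2P d4.
exists m4; split; [| | |by right].
- suff <- : U :\ u :|: V :\ v :|: Z :\ b :\ z :|: [set u; b] :|: [set z; v] = setT by [].
  apply/setP=> x; rewrite !inE inZ.
  case: (x == u); case: (x == b); case: (x == z); case: (x == v); rewrite ?orbT //=.
  by case: (x \in U); case: (x \in V).
- apply: (mcut1 uU).
    by rewrite m43 ?m3e ?e1u // !inE eqxx ?orbT.
  move=> x xU; rewrite m43; last by rewrite !in_setU xU.
  rewrite m32; last by rewrite !in_setU xU.
  rewrite m21; last by rewrite !in_setU xU.
  by rewrite m1U //; apply: pm_stable f1P _.
- apply: (mcut1 vV); first by rewrite m4e ?e2v ?zV // !inE eqxx orbT.
  move=> x xV; rewrite m43; last by rewrite !in_setU xV !orbT.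
  rewrite m32; last by rewrite !in_setU xV orbT.
  rewrite m21; last by rewrite !in_setU xV orbT.
  by rewrite m1V //; apply: pm_stable f2P _.
Qed.

(** These are the odd sets whose term in the total weakness grows when [m'] replaces [m]. *)
Let bad m m' V := odd #|V| && (cut (H m') V < minn d./2 (cut (H m) V)).

Lemma badP m m' V : pm K setT m -> pm K setT m' -> bad m m' V ->
  [/\ odd #|V|, weak m' V & mcut m V < mcut m' V].
Proof.
move=> mP m'P /andP[oV]; rewrite leq_min => /andP[wV lt]; split=> //.
have := cut_del V mP; rewrite (cut_del V m'P) -!/(H _); move: lt.
by move: (mcut _ V) (mcut _ V) (cut _ _) (cut _ _); clear; lia.
Qed.

(** If [U] met both [V] and its complement, it would contain two pieces of at least [d] vertices
    each. Badness is invariant under complement, so [V] may be replaced by the side that avoids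
    [U]. *)
Lemma bad_disjoint m m' U V : pm K setT m -> pm K setT m' -> weak m U ->
  #|U| < 2 * d -> bad m m' V -> exists2 V', bad m m' V' & [disjoint U & V'].
Proof.
move=> mP m'P wU leU bV; have [oV wV _] := badP mP m'P bV.
have [UV0|UV] := eqVneq (U :&: V) set0; first by exists V => //; rewrite -setI_eq0 UV0.
have [UV0|UVc] := eqVneq (U :&: ~: V) set0.
  exists (~: V); last by rewrite -setI_eq0 UV0.
  by move: bV; rewrite /bad odd_setC !cutC //; apply: HS.
have := piece_size mP m'P wU wV UV.
have : d <= #|U :&: ~: V| by apply: (piece_size mP m'P wU _ UVc); rewrite weakC .
have := cardsID V U; rewrite -setDE; move: leU.
by move: #|_| #|_| #|U|; clear; lia.
Qed.

Lemma disjoint_sum3 (X Y Z : {set T}) : [disjoint X & Y] -> Z = ~: (X :|: Y) ->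
  #|X| + #|Y| + #|Z| = #|T|.
Proof.
by move=> dXY ->; rewrite -(cardsC (X :|: Y)) cardsU (disjoint_setI0 dXY) cards0 subn0.
Qed.

(** Writing off one edge of each matching, every vertex of [W] sends at least [d - 1 - #|W|] edges
    into the three weak cuts. For [3 <= #|W| <= d - 3] this exceeds their total. *)
Lemma odd3_set1 m1 m2 m3 X1 X2 X3 W :
  pm K setT m1 -> pm K setT m2 -> pm K setT m3 ->
  weak m1 X1 -> weak m2 X2 -> weak m3 X3 ->
  W = ~: (X1 :|: X2 :|: X3) -> odd #|W| -> #|W| + 3 <= d -> #|W| = 1.
Proof.
move=> m1P m2P m3P w1 w2 w3 WE oW leW.
pose out x := deg_in (H m1) x X1 + deg_in (H m2) x X2 + deg_in (H m3) x X3.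
have outP : {in W, forall x, d.-1 <= #|W| + out x}.
  move=> x xW; have /andP[+ _] := Kd x; have := deg_in_self KI xW.
  have : deg_in K x setT <= deg_in K x W + deg_in K x (~: W).
    by apply: deg_in_cover => y _ _; rewrite setUCr inE.
  have : deg_in K x (~: W) <= deg_in K x (X1 :|: X2) + deg_in K x X3.
    by apply: deg_in_cover => y; rewrite WE setCK.
  have : deg_in K x (X1 :|: X2) <= deg_in K x X1 + deg_in K x X2.
    by apply: deg_in_cover => y.
  have := deg_out x X1 m1P; have := deg_out x X2 m2P; have := deg_out x X3 m3P.
  rewrite /out; move: #|W| (deg_in K x setT) (deg_in K x W) (deg_in K x (~: W)).
  move: (deg_in K x (_ :|: _)) (deg_in K x X1) (deg_in K x X2) (deg_in K x X3).
  by move: (deg_in _ x X1) (deg_in _ x X2) (deg_in _ x X3); clear; lia.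
have lo : #|W| * d.-1 <= #|W| * #|W| + \sum_(x in W) out x.
  by rewrite -!sum_nat_const -big_split; apply: leq_sum.
have hi : \sum_(x in W) out x <= cut (H m1) X1 + cut (H m2) X2 + cut (H m3) X3.
  rewrite !big_split -[cut _ X1]cutC -?[cut _ X2]cutC -?[cut _ X3]cutC; try exact: HS.
  rewrite !leq_add //; apply: linksS; rewrite ?setCK // WE setCS.
  - by rewrite -setUA subsetUl.
  - by rewrite setUAC subsetUr.
  by rewrite subsetUr.
have [dh1 dh2] := half_bounds d; have [|w3'] := leqP #|W| 2.
  by case: #|W| oW => [|[|[|]]].
exfalso; move: lo hi w1 w2 w3 w3' leW dh1 dh2 d9; rewrite /weak.
move: (cut _ X1) (cut _ X2) (cut _ X3) (\sum_(x in W) _) #|W| d./2; clear.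
move=> c1 c2 c3 o w h lo hi w1 w2 w3 w3' leW dh1 dh2 d9.
(* After this substitution the only nonlinear term left is [a * e], and its sign suffices. *)
have [a wE] : exists a, w = a + 3 by exists (w - 3); lia.
have [e dE] : exists e, d = w + 3 + e by exists (d - w - 3); lia.
have dE' : d.-1 = w + 2 + e by lia.
rewrite dE' wE in lo; have := leq0n (a * e); lia.
Qed.

(** [swap_one] repairs [U]. If a bad set [V] appears, [swap_two] repairs [U] and [V] together, and a
    further bad set [V3] is ruled out by size and crossing counts. *)
Lemma swap m U : pm K setT m -> odd #|U| -> #|U| < 2 * d ->
  cut (del K m) U < d./2 -> 3 <= mcut m U ->
  exists m', [/\ pm K setT m', cut (del K m) U < cut (del K m') U
    & forall V, odd #|V| -> minn d./2 (cut (del K m) V) <= cut (del K m') V].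
Proof.
move=> mP oU leU wU m3; rewrite -/(H m).
have better m' : pm K setT m' -> mcut m' U = 1 -> cut (H m) U < cut (H m') U.
  move=> m'P m'U; have := cut_del U mP; rewrite (cut_del U m'P) m'U -!/(H _).
  by move: m3; move: (mcut m U) (cut _ _) (cut _ _); clear; lia.
have mc1 f X : pm K setT f -> odd #|X| -> 0 < mcut f X.
  by move=> fP oX; have := mcut_odd fP oX; case: mcut.
have [m' m'P m'U] := swap_one mP oU leU wU.
case: (pickP (bad m m')) => [V0 bV0|good]; last first.
  exists m'; split=> // [|V oV]; first exact: better.
  by have := good V; rewrite /bad oV /= ltnNge => /negbFE.
have [V bV dUV] := bad_disjoint mP m'P wU leU bV0; have [oV wV ltV] := badP mP m'P bV.
have nz X : odd #|X| -> X != set0.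
  by move=> oX; apply: contraTneq oX => ->; rewrite cards0.
have szU := weak_size mP wU (nz _ oU); have szV := weak_size m'P wV (nz _ oV).
set Z := ~: (U :|: V).
have sum3 : #|U| + #|V| + #|Z| = #|T| by apply: disjoint_sum3.
(* Otherwise [V] is the complement of [U], which [m'] crosses once; but a bad set is crossed more
   often by [m'] than by [m], hence at least twice. *)
have Znz : Z != set0.
  apply/negP=> /eqP Z0; have VE : V = ~: U.
    apply/setP=> x; rewrite inE; have : x \notin Z by rewrite Z0 inE.
    rewrite !inE negbK; have [xU _|//] := boolP (x \in U).
    by rewrite (disjointFr dUV).
  by move: ltV; rewrite VE (mcutC _ m'P) m'U ltnNge mc1 // odd_setC.
have dZ f V' : pm K setT f -> weak f V' -> ~: (U :|: V') != set0 ->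
    d <= #|~: (U :|: V')|.
  move=> fP wV'; rewrite setCU => nz'.
  by apply: (piece_size mP fP) nz'; rewrite weakC //.
have szZ := dZ _ _ m'P wV Znz.
have [|||m'' [m''P m''U m''V alt]] :=
    @swap_two m m' U V Z mP m'P oU oV dUV wU wV leU _ erefl _ _ m'U.
- by move: szU szZ sum3 leT; rewrite -/Z; move: #|U| #|V| #|Z| #|T|; clear; lia.
- move/(congr1 odd): sum3; rewrite !oddD oU oV (negPf evT) /= => ->.
  by [].
- by move: szU szV sum3 leT; move: #|U| #|V| #|Z| #|T|; clear; lia.
exists m''; split=> // [|V1 oV1]; first exact: better.
rewrite leqNgt; apply/negP=> bad1; have {bad1} bV1 : bad m m'' V1 by rewrite /bad oV1.
have [V3 bV3 dUV3] := bad_disjoint mP m''P wU leU bV1.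
have [oV3 wV3 ltV3] := badP mP m''P bV3.
have szV3 := weak_size m''P wV3 (nz _ oV3).
have mV3 := mc1 m V3 mP oV3.
(* If [V3] meets [V], then either [V3] splits [V], or it contains [V] properly. In both cases four
   disjoint pieces of at least [d] vertices arise, one of them [U] with more than [d], against
   [#|T| <= 4 * d]. *)
have [VV3|VV3] := eqVneq (V :&: V3) set0; last first.
  have [VV3'|VV3'] := eqVneq (V :&: ~: V3) set0; last first.
    have := piece_size m'P m''P wV wV3 VV3.
    have : d <= #|V :&: ~: V3| by apply: (piece_size m'P m''P wV _ VV3'); rewrite weakC.
    have := cardsID V3 V; rewrite -setDE; move: szU szZ sum3 leT; rewrite -/Z.
    by move: #|_| #|_| #|U| #|V| #|Z| #|T|; clear; lia.
  have VsV3 : V \subset V3 by rewrite -setD_eq0 setDE VV3'.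
  have nVV3 : V3 :&: ~: V != set0.
    rewrite -setDE; apply/negP; rewrite setD_eq0 => V3sV.
    have VE : V3 = V by apply/eqP; rewrite eqEsubset V3sV.
    by move: ltV3; rewrite VE m''V ltnNge mc1.
  have : d <= #|V3 :&: ~: V| by apply: (piece_size m''P m'P wV3 _ nVV3); rewrite weakC.
  have ZV3nz : ~: (U :|: V3) != set0.
    apply/negP=> /eqP Z0; have VE : V3 = ~: U.
      apply/setP=> x; rewrite inE; have : x \notin ~: (U :|: V3) by rewrite Z0 inE.
      rewrite !inE negbK; have [xU _|//] := boolP (x \in U).
      by rewrite (disjointFr dUV3).
    by move: ltV3; rewrite VE (mcutC _ m''P) m''U ltnNge mc1 // odd_setC.
  have := dZ _ _ m''P wV3 ZV3nz.
  have := disjoint_sum3 dUV3 (erefl _); have := cardsID V V3.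
  rewrite (setIidPr VsV3) -setDE; move: szU szV leT.
  by move: #|_| #|_| #|_| #|_| #|_| #|_|; clear; lia.
(* What is left: three odd, nearly closed sets and a single further vertex. *)
set W := ~: (U :|: V :|: V3).
have dVV3 : [disjoint V & V3] by rewrite -setI_eq0 VV3.
have dUVV3 : [disjoint U :|: V & V3].
  by rewrite -setI_eq0 setIUl (disjoint_setI0 dUV3) VV3 setU0.
have sum4 : #|U| + #|V| + #|V3| + #|W| = #|T|.
  rewrite -(disjoint_sum3 dUVV3 (erefl _)) cardsU (disjoint_setI0 dUV) cards0 subn0.
  by [].
have oW : odd #|W|.
  move/(congr1 odd): sum4; rewrite !oddD oU oV oV3 (negPf evT) /=.
  by case: odd.
have W1 : #|W| = 1.
  apply: (odd3_set1 mP m'P m''P wU wV wV3) => //.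
  by move: szU szV szV3 sum4 leT; move: #|U| #|V| #|V3| #|W| #|T|; clear; lia.
have m''K := pm_inv m''P; have mK := pm_inv mP.
have inW x : (x \in W) = [&& x \notin U, x \notin V & x \notin V3].
  by rewrite !inE !negb_or -andbA.
have V3U x : x \in V3 -> (x \in U) = false by move=> xV; rewrite (disjointFl dUV3).
have V3V x : x \in V3 -> (x \in V) = false by move=> xV; rewrite (disjointFl dVV3).
(* If [m''] preserves [Z], which is [V3] together with the single vertex of [W], it crosses [V3] at
   most once, no more than [m] does. *)
case: alt => [stZ|noUV].
  move: ltV3; rewrite ltnNge => /negP; apply; apply: leq_trans mV3.
  rewrite -W1 /mcut -(card_imset _ (inv_inj m''K)); apply: subset_leq_card.
  apply/subsetP=> _ /imsetP[x + ->]; rewrite inE => /andP[xV3 nmx].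
  have : m'' x \in Z by apply: stZ; rewrite !inE V3U ?V3V.
  by rewrite inW nmx andbT !inE negb_or.
(* At most one crossing edge each goes to [U], to [V] and to the vertex of [W]. As [m] crosses [V3]
   fewer times and oddly often, it does so once. *)
have le3 : mcut m'' V3 <= 3.
  rewrite /mcut -(card_imset _ (inv_inj m''K)).
  apply: (@leq_trans #|crossers m'' U :|: crossers m'' V :|: W|).
    apply: subset_leq_card; apply/subsetP=> _ /imsetP[x + ->].
    rewrite inE => /andP[xV3 nmx].
    rewrite !in_setU inW nmx !inE m''K (V3U x xV3) (V3V x xV3) !andbT.
    by case: (m'' x \in U); case: (m'' x \in V).
  apply: leq_trans (leq_card_setU _ _) _; rewrite W1 -[3]/(2 + 1) leq_add2r.
  by apply: leq_trans (leq_card_setU _ _) _; rewrite -!/(mcut _ _) m''U m''V.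
have one : mcut m V3 = 1.
  have := mcut_odd mP oV3; have := leq_trans ltV3 le3.
  by case: (mcut m V3) => [|[|[|]]].
(* Edges of [m] leaving [U] avoid [V], so at most one ends in [W] and at most one in [V3],
   contradicting three crossings. *)
move: m3; rewrite leqNgt => /negP; apply; rewrite ltnS.
rewrite /mcut -(card_imset _ (inv_inj mK)).
apply: (@leq_trans #|W :|: crossers m V3|); last first.
  by apply: leq_trans (leq_card_setU _ _) _; rewrite -/(mcut _ _) one W1.
apply: subset_leq_card; apply/subsetP=> _ /imsetP[x + ->].
rewrite inE => /andP[xU nmx]; have Kx := pm_adj mP (in_setT x).
have nV : m x \notin V by apply: contraL Kx; apply: noUV.
rewrite in_setU inW nmx nV /= inE mK (disjointFr dUV3 xU) andbT.
by rewrite orNb.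
Qed.

End WeakCuts.

(** * Packings of perfect matchings *)

Section Packings.

Variables (T : finType) (e : rel T).
Hypotheses (eS : symmetric e) (eI : irreflexive e).
Implicit Types (X U : {set T}) (m f : {ffun T -> T}) (F : seq {ffun T -> T}).

Fixpoint rest F : rel T := if F is f :: F' then del (rest F') f else e.

(** Each matching is perfect in what the matchings behind it leave, so disjointness is built in; the
    head is the one removed last. *)
Fixpoint packing F : Prop :=
  if F is f :: F' then pm (rest F') setT f /\ packing F' else True.

Lemma rest_sym F : packing F -> symmetric (rest F).
Proof. by elim: F => //= f F IHF [fP /IHF]; move/del_sym; apply; apply: pm_inv fP. Qed.

Lemma rest_irr F : irreflexive (rest F).
Proof. by elim: F => //= f F; apply: del_irr. Qed.

Lemma rest_sub F : subrel (rest F) e.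
Proof. by elim: F => //= f F IHF x y /andP[/IHF]. Qed.

Lemma rest_avoid F f x y : f \in F -> rest F x y -> f x != y.
Proof.
elim: F => //= a F IHF; rewrite inE => /predU1P[-> /andP[]//|fF /andP[+ _]].
exact: IHF.
Qed.

Lemma packing_pm F f : packing F -> f \in F -> pm e setT f.
Proof.
elim: F => //= a F IHF [aP FP]; rewrite inE => /predU1P[->|]; last exact: IHF.
exact: pm_mono (@rest_sub F) aP.
Qed.

Lemma packing_disjoint F f g x : packing F -> f \in F -> g \in F -> f x = g x -> f = g.
Proof.
elim: F => //= a F IHF [aP FP].
have ne h : h \in F -> h x <> a x.
  by move=> hF; apply/eqP/(rest_avoid hF); apply: pm_adj aP _.
rewrite !inE => /predU1P[->|fF] /predU1P[->|gF] //; last exact: IHF.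
  by move=> E; case: (ne g gF).
by move=> E; case: (ne f fF).
Qed.

Lemma packing_uniq F : 0 < #|T| -> packing F -> uniq F.
Proof.
case/card_gt0P=> x _; elim: F => //= a F IHF [aP FP]; rewrite IHF // andbT.
apply/negP=> aF; have := rest_avoid aF (pm_adj aP (in_setT x)).
by rewrite eqxx.
Qed.

Lemma packing_deg F x : packing F ->
  deg_in e x setT = deg_in (rest F) x setT + size F.
Proof.
elim: F => [|f F IHF] /=; first by rewrite addn0.
by case=> fP /IHF ->; rewrite (deg_del _ _ fP) inE -addnA add1n.
Qed.

Lemma packing_cut F X : packing F ->
  cut e X = cut (rest F) X + \sum_(f <- F) mcut f X.
Proof.
elim: F => [|f F IHF] /=; first by rewrite big_nil addn0.
by case=> fP /IHF ->; rewrite big_cons (cut_del _ fP) addnA.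
Qed.

(** The order of removal is immaterial: any member can be made the last one removed, which is the
    position where [swap] acts. *)
Lemma packing_front F f : packing F -> f \in F ->
  exists F', [/\ packing (f :: F'), size (f :: F') = size F
    & rest (f :: F') =2 rest F].
Proof.
elim: F => //= a F IHF [aP FP]; rewrite inE => /predU1P[->|fF]; first by exists F.
have [F' [[fP F'P] sz E]] := IHF FP fF.
exists (a :: F'); split=> [||x y] /=; last 1 first.
- by rewrite /del -[rest F x y]E /= /del andbAC.
- have aP' : pm (del (rest F') f) setT a by apply: pm_mono aP => x y; rewrite -E.
  split; last by split=> //; apply: pm_mono aP'; apply: del_sub.
  case: (fP) => /is_mtchP[fK fg fA] fnz; split=> //; apply/is_mtchP; split=> // x fx.
  rewrite /del fg //=; have /andP[_] := pm_adj aP' (in_setT x).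
  by rewrite eq_sym.
by rewrite -sz.
Qed.

Lemma eq_cut (g1 g2 : rel T) X : g1 =2 g2 -> cut g1 X = cut g2 X.
Proof.
move=> E; apply: eq_bigr => x _; congr #|pred_of_set _|; apply/setP=> y.
by rewrite !inE E.
Qed.

Variable c : nat.
Hypotheses (c9 : 9 <= c) (evT : ~~ odd #|T|) (leT : #|T| <= 4 * c)
  (ed : forall x, 2 * c - 1 <= deg_in e x setT <= 2 * c).

Lemma rest_deg F x : packing F -> size F < c ->
  2 * c - 1 - size F <= deg_in (rest F) x setT <= (2 * c - 1 - size F).+1.
Proof.
move=> FP szF; have := ed x; rewrite (packing_deg x FP); move: szF.
by move: (deg_in _ x _) (size F); clear; lia.
Qed.

(** The truncated subtraction makes only odd cuts with fewer than [h] edges contribute. *)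
Definition weakness h F :=
  \sum_(X : {set T} | odd #|X|) (h - cut (rest F) X).

(** One of [X] and its complement has at most half of the vertices, hence at most [2 * c], and
    oddness excludes equality. *)
Lemma weak_side F h X : packing F -> odd #|X| -> cut (rest F) X < h ->
  exists U, [/\ odd #|U|, cut (rest F) U < h & #|U| < 2 * c].
Proof.
move=> FP oX wX; have oC : odd #|~: X| by rewrite odd_setC.
have small Y : odd #|Y| -> 2 * #|Y| <= #|T| -> #|Y| < 2 * c.
  move=> oY le; have ne : #|Y| != 2 * c by apply: contraTneq oY => ->; rewrite oddM.
  by move: le leT ne; move: #|Y| #|T|; clear; lia.
have := cardsC X; have [le|gt] := leqP (2 * #|X|) #|T| => E.
  by exists X; split=> //; apply: small.
exists (~: X); split=> //; first by rewrite cutC //; apply: rest_sym.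
by apply: small => //; move: E gt; move: #|X| #|~: X| #|T|; clear; lia.
Qed.

(** With fewer than [2 * c] vertices, [U] has a cut of at least [2 * c - 1] edges in [e]. Crossing
    numbers are odd; if all were one, the matchings and the rest would account for fewer than
    [size F + d] edges. *)
Lemma packing_crossing F d U : packing F -> size F + d = 2 * c - 1 -> odd #|U| ->
  #|U| < 2 * c -> cut (rest F) U < d -> exists2 f, f \in F & 3 <= mcut f U.
Proof.
move=> FP szF oU leU ltU.
have lo : 2 * c - 1 <= cut e U.
  rewrite leqNgt; apply/negP=> lt.
  have := @weak_large _ e _ U eI (fun x => proj1 (andP (ed x))) lt.
  rewrite -card_gt0; case: #|U| oU leU => // u _ leU /(_ isT).
  by move: leU; clear; lia.
have [/hasP[f fF f3]|/hasPn no3] := boolP (has (fun f => 3 <= mcut f U) F).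
  by exists f.
have : \sum_(f <- F) mcut f U <= size F.
  rewrite -sum1_size big_seq [leqRHS]big_seq; apply: leq_sum => f fF.
  have := no3 f fF; have := mcut_odd (packing_pm FP fF) oU.
  by case: mcut => [|[|[|]]].
move: lo; rewrite (packing_cut U FP); move: szF ltU.
by move: (cut _ U) (\sum_(f <- F) _) (size F); clear; lia.
Qed.

Lemma packing_extend F : packing F -> size F < c ->
  exists2 F', packing F' & size F' = (size F).+1.
Proof.
have [k] := ubnP (weakness (2 * c - 1 - size F)./2 F).
elim: k F => // k IHk F + FP rc; set r := size F in rc *.
have szF : size F = r by []; clearbody r.
set d := 2 * c - 1 - r => ltk.
have gd x := rest_deg x FP; rewrite szF -/d in gd.
have [cd [d9 leTd]] : c <= d /\ 9 <= d /\ #|T| <= 4 * d.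
  by rewrite /d; move: leT c9 rc; move: #|T|; clear; lia.
case: (pickP [pred X : {set T} | odd #|X| && (cut (rest F) X < d./2)]); last first.
  move=> strong; have [|m mP] := @pm_of_no_weak _ (rest F) d (rest_sym FP)
      (@rest_irr F) (fun x => gd x rc) evT leTd d9.
    by move=> X oX; rewrite leqNgt; have := strong X; rewrite /= oX /= => ->.
  by exists (m :: F); rewrite //= szF.
move=> X /andP[/= oX wX]; have [U [oU wU leU]] := weak_side FP oX wX.
have [||f fF f3] := packing_crossing (d := d) FP _ oU leU.
- by rewrite szF /d; move: rc; clear; lia.
- by apply: leq_trans wU _; have [] := half_bounds d; clear; lia.
(* Putting [f] back raises the degrees to [d + 1] or [d + 2], the setting of [swap]. *)
have [F' [[fP F'P] sz E]] := packing_front FP fF.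
have szF' : size F' + 1 = r by rewrite -szF -sz addn1.
have F'c : size F' < c by move: szF' rc; clear; lia.
have dE : 2 * c - 1 - size F' = d.+1 by rewrite /d; move: szF' rc; clear; lia.
have Kd x := rest_deg x F'P F'c; rewrite dE in Kd.
have cutE Y : cut (del (rest F') f) Y = cut (rest F) Y by apply: eq_cut.
have [||m [mP ltU leV]] := @swap _ (rest F') d (rest_sym F'P) (@rest_irr F') Kd
    evT leTd d9 f U fP oU _ _ f3.
- by move: leU cd; move: #|U|; clear; lia.
- by rewrite cutE.
have sm : size (m :: F') = r by rewrite -szF -sz.
have := IHk (m :: F'); rewrite sm; apply=> //.
(* The number of matchings, and with it the threshold, is unchanged; the term of [U] drops strictly
   and no other term grows. *)
rewrite -ltnS; apply: leq_trans ltk; rewrite ltnS /weakness.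
rewrite (bigD1 U) //= [leqRHS](bigD1 U) //= -addSn; apply: leq_add.
  by move: ltU wU; rewrite cutE; move: (cut _ U) (cut _ U) d./2; clear; lia.
apply: leq_sum => V /andP[oV _]; have := leV V oV; rewrite cutE.
by move: (cut _ V) (cut _ V) d./2; clear; lia.
Qed.

Lemma ex_packing : exists2 F, packing F & size F = c.
Proof.
suff ex k : k <= c -> exists2 F, packing F & size F = k by apply: ex.
elim: k => [|k IHk] lek; first by exists [::].
have [F FP szF] := IHk (ltnW lek); rewrite -szF in lek *.
exact: packing_extend.
Qed.

End Packings.

(** * From involutions to sets of edges, and the theorem *)

Section EdgeSets.

Variables (T : finType) (e : rel T).
Implicit Types (m f : {ffun T -> T}).

Definition edge_set m : {set {set T}} := [set [set x; m x] | x in T].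

Lemma edge_set_perfect m : pm e setT m -> perfect_matching e (edge_set m).
Proof.
move=> mP; have mK := pm_inv mP; apply/andP; split; last first.
  apply/eqP/setP=> x; rewrite inE; apply/bigcupP; exists [set x; m x].
    exact: imset_f.
  by rewrite !inE eqxx.
apply/andP; split.
  apply/subsetP=> _ /imsetP[x _ ->]; apply/imset2P.
  by exists x (m x) => //; rewrite inE /=; apply: pm_adj mP _.
apply/trivIsetP=> _ _ /imsetP[x _ ->] /imsetP[y _ ->] ne.
rewrite -setI_eq0; apply: contraR ne => /set0Pn[z]; rewrite !inE.
have edgeE u v : (v == u) || (v == m u) -> [set u; m u] = [set v; m v].
  by case/orP=> /eqP -> //; rewrite mK setUC.
by case/andP=> /edgeE -> /edgeE ->.
Qed.

Lemma edge_set_meet f m E : involutive m -> E \in edge_set f -> E \in edge_set m ->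
  exists x, f x = m x.
Proof.
move=> mK /imsetP[x _ ->] /imsetP[y _ E1].
have : (x == y) || (x == m y) by have := set21 x (f x); rewrite E1 !inE.
have fx : (f x == y) || (f x == m y) by have := set22 x (f x); rewrite E1 !inE.
case/orP=> /eqP xE; exists x.
  move: fx; rewrite -xE; case/orP=> /eqP // fx.
  have : m x \in [set y; m y] by rewrite xE !inE eqxx orbT.
  by rewrite -E1 fx !inE orbb => /eqP ->.
move: fx; rewrite xE mK; case/orP=> /eqP // fx.
have : y \in [set y; m y] by rewrite !inE eqxx.
by rewrite -E1 xE fx !inE orbb => /eqP <-.
Qed.

End EdgeSets.

Theorem theorem3p3 (n : nat) (T : finType) (e : rel T)
    (n_ge34 : 34 <= n) (n_even : ~~ odd n)
    (e_simple : simple_graph e) (order_T : #|T| = n)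
    (deg_e : forall x : T, degree e x = Dn n \/ degree e x = Dn n + 1) :
  exists F : {set {set {set T}}},
    [/\ ceil_div n 4 <= #|F|,
        forall M, M \in F -> perfect_matching e M
      & forall M N, M \in F -> N \in F -> M <> N -> [disjoint M & N]].
Proof.
have [eS eI] := e_simple; set c := ceil_div n 4.
(* The bound [34 <= n] is exactly what gives [c >= 9], on which the counting estimates rely. *)
have [c9 nc] : 9 <= c /\ n <= 4 * c.
  by rewrite /c /ceil_div; move: n_ge34; clear; lia.
have [|||F FP szF] := @ex_packing T e eS eI c c9.
- by rewrite order_T.
- by rewrite order_T.
- move=> x; have -> : deg_in e x setT = degree e x.
    by congr #|pred_of_set _|; apply/setP=> y; rewrite !inE.
  by have := deg_e x; rewrite /Dn -/c; move: (degree e x) c9; clear; lia.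
have T0 : 0 < #|T| by rewrite order_T; apply: leq_trans n_ge34.
have meet f g E : f \in F -> g \in F -> E \in edge_set f -> E \in edge_set g -> f = g.
  move=> fF gF Ef Eg; have gK := pm_inv (packing_pm FP gF).
  have [x fx] := edge_set_meet gK Ef Eg; exact: packing_disjoint FP fF gF fx.
have inj : {in F &, injective (@edge_set T)}.
  move=> f g fF gF fg; have /card_gt0P[x _] := T0.
  have Ef : [set x; f x] \in edge_set f by apply: imset_f.
  by apply: (meet f g _ fF gF Ef); rewrite -fg.
exists [set:: [seq edge_set f | f <- F]]; split.
- rewrite cardsE -szF -(size_map (@edge_set T)); apply/eq_leq/esym/card_uniqP.
  by rewrite map_inj_in_uniq // (packing_uniq T0 FP).
- by move=> _ /[!inE] /mapP[f fF ->]; apply: edge_set_perfect; apply: packing_pm FP fF.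
move=> _ _ /[!inE] /mapP[f fF ->] /mapP[g gF ->] ne.
rewrite -setI_eq0; apply/eqP/setP=> E; rewrite !inE; apply/negP=> /andP[Ef Eg].
by apply: ne; rewrite (meet f g E).
Qed.
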